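(* Let $0<\alpha<1$. On the Barrier surface, that is, when the state $\mathbf{x}=(x_T,y_T,x_A,y_A,x_D,y_D)$ satisfies $\mathbf{x}\in\mathcal{B}$, the Capture Differential Game (CDG) and the Active Target Defense Differential Game (ATDDG) provide the same solution (the same optimal strategies of the three players) and the same Value of the game.
   Context: **Dynamics.** Three players move in the plane: a Target $T$ at $(x_T,y_T)$, an Attacker $A$ at $(x_A,y_A)$, a Defender $D$ at $(x_D,y_D)$. $A$ and $D$ have speed $1$ and $T$ has speed $\alpha$. The controls are the instantaneous headings $\phi$ (of $T$), $\chi$ (of $A$), $\psi$ (of $D$), all in $[-\pi,\pi]$. The dynamics are $$\dot x_A=\cos\chi,\ \dot y_A=\sin\chi,\ \dot x_D=\cos\psi,\ \dot y_D=\sin\psi,\ \dot x_T=\alpha\cos\phi,\ \dot y_T=\alpha\sin\phi .$$ Target and Defender form a team with control $\{\phi,\psi\}$; the Attacker's control is $\{\chi\}$. All players know $\alpha$ and the current state; strategies are state feedback strategies, and no player knows the opponent's current control choice. Optimal strategies are the saddle-point strategies attaining the (max-min) Value of the respective game. **Capture Differential Game (CDG).** The game ends at the (free) time $t_f$ at which $x_A=x_T$ and $y_A=y_T$ (the Attacker captures the Target). The payoff is the terminal $D$-$T$ distance $\sqrt{(x_D(t_f)-x_T(t_f))^2+(y_D(t_f)-y_T(t_f))^2}$, which the Attacker maximizes and the Target/Defender team minimizes. **Active Target Defense Differential Game (ATDDG).** The game ends at the (free) time $t_f$ at which $x_A=x_D$ and $y_A=y_D$ (the Defender intercepts the Attacker).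 The payoff is the terminal $A$-$T$ distance $\sqrt{(x_A(t_f)-x_T(t_f))^2+(y_A(t_f)-y_T(t_f))^2}$, which the Target/Defender team maximizes and the Attacker minimizes. When the state is on the Barrier surface, both games are feasible; simultaneous capture of $T$ by $A$ and interception of $A$ by $D$ is admitted at termination. **Barrier surface.** Let $$\mathcal{R}_{ed}=\Big\{\mathbf{x}\ \Big|\ \sqrt{(x_A-x_T)^2+(y_A-y_T)^2}-\sqrt{(x_D-x_T)^2+(y_D-y_T)^2}\ge 0\Big\},$$ $$\mathcal{B}=\{\mathbf{x}\mid \mathbf{x}\notin\mathcal{R}_{ed},\ B(\mathbf{x};\alpha)=0\},$$ where $$B(\mathbf{x};\alpha)=b_{xx}x_T^2+b_{yy}y_T^2+2b_{xy}x_Ty_T+2b_xx_T+2b_yy_T+b$$ with $b_{xx}=\cos^2\sigma-\alpha^2$, $b_{yy}=\sin^2\sigma-\alpha^2$, $b_{xy}=\sin\sigma\cos\sigma$, $b_x=\alpha^2x_A\sin^2\sigma-(1-\alpha^2)x_0\cos^2\sigma-[\alpha^2y_A+(1-\alpha^2)y_0]\sin\sigma\cos\sigma$, $b_y=\alpha^2y_A\cos^2\sigma-(1-\alpha^2)y_0\sin^2\sigma-[\alpha^2x_A+(1-\alpha^2)x_0]\sin\sigma\cos\sigma$, $b=\big([\alpha^2y_A+(1-\alpha^2)y_0]\sin\sigma+[\alpha^2x_A+(1-\alpha^2)x_0]\cos\sigma\big)^2-\alpha^2(x_A^2+y_A^2)$, and $\cos\sigma=\frac{x_A-x_D}{\sqrt{(x_A-x_D)^2+(y_A-y_D)^2}}$,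 $\sin\sigma=\frac{y_A-y_D}{\sqrt{(x_A-x_D)^2+(y_A-y_D)^2}}$, $x_0=\frac12(x_A+x_D)$, $y_0=\frac12(y_A+y_D)$. *)

(* Defs.v *)
(* MathComp-Analysis; the real line is an arbitrary [R : realType]. *)
From mathcomp Require Import all_boot all_order all_algebra.
From mathcomp Require Import all_classical all_reals all_analysis.

Set Implicit Arguments.
Unset Strict Implicit.
Unset Printing Implicit Defensive.

Import Order.TTheory GRing.Theory Num.Theory.
Import numFieldNormedType.Exports.

Local Open Scope classical_set_scope.
Local Open Scope ring_scope.

Section StateSpace.
Variable R : realType.

(* ((T, A), D), each player being a point of the plane. *)
Definition state : Type := ((R * R) * (R * R) * (R * R))%type.

Implicit Types x : state.

Definition posT x : R * R := x.1.1.
Definition posA x : R * R := x.1.2.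
Definition posD x : R * R := x.2.

Definition xT x : R := (posT x).1.
Definition yT x : R := (posT x).2.
Definition xA x : R := (posA x).1.
Definition yA x : R := (posA x).2.
Definition xD x : R := (posD x).1.
Definition yD x : R := (posD x).2.

(* Euclidean: the library norm on a product is the sup norm. *)
Definition dist (p q : R * R) : R :=
  Num.sqrt ((p.1 - q.1) ^+ 2 + (p.2 - q.2) ^+ 2).

Definition captured x : bool := posA x == posT x.
Definition intercepted x : bool := posA x == posD x.

Definition Red : set state :=
  [set x | 0 <= dist (posA x) (posT x) - dist (posD x) (posT x)].

(* When A = D the quotients are 0 by the convention z / 0 = 0; no such state
   lies on the barrier, because it would belong to [Red]. *)
Definition cos_sigma x : R := (xA x - xD x) / dist (posA x) (posD x).
Definition sin_sigma x : R := (yA x - yD x) / dist (posA x) (posD x).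
Definition x0 x : R := (xA x + xD x) / 2.
Definition y0 x : R := (yA x + yD x) / 2.

Definition bxx (alpha : R) x : R := cos_sigma x ^+ 2 - alpha ^+ 2.
Definition byy (alpha : R) x : R := sin_sigma x ^+ 2 - alpha ^+ 2.
Definition bxy x : R := sin_sigma x * cos_sigma x.
Definition bx (alpha : R) x : R :=
  alpha ^+ 2 * xA x * sin_sigma x ^+ 2
  - (1 - alpha ^+ 2) * x0 x * cos_sigma x ^+ 2
  - (alpha ^+ 2 * yA x + (1 - alpha ^+ 2) * y0 x)
    * sin_sigma x * cos_sigma x.
Definition by_ (alpha : R) x : R :=
  alpha ^+ 2 * yA x * cos_sigma x ^+ 2
  - (1 - alpha ^+ 2) * y0 x * sin_sigma x ^+ 2
  - (alpha ^+ 2 * xA x + (1 - alpha ^+ 2) * x0 x)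
    * sin_sigma x * cos_sigma x.
Definition b (alpha : R) x : R :=
  ((alpha ^+ 2 * yA x + (1 - alpha ^+ 2) * y0 x) * sin_sigma x
   + (alpha ^+ 2 * xA x + (1 - alpha ^+ 2) * x0 x) * cos_sigma x) ^+ 2
  - alpha ^+ 2 * (xA x ^+ 2 + yA x ^+ 2).

Definition B (alpha : R) x : R :=
  bxx alpha x * xT x ^+ 2 + byy alpha x * yT x ^+ 2
  + 2 * bxy x * xT x * yT x
  + 2 * bx alpha x * xT x + 2 * by_ alpha x * yT x + b alpha x.

Definition Barrier (alpha : R) : set state :=
  [set x | ~ Red x /\ B alpha x = 0].

End StateSpace.

Section Plays.
Variables (R : realType) (alpha : R).

Implicit Types (x : state R) (phi psi chi : state R -> R)
  (z : R -> state R) (tf : \bar R).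

(* A state feedback strategy: the heading is a function of the current state
   only. No regularity is imposed. *)
Definition feedback (h : state R -> R) : Prop := forall x, - pi <= h x <= pi.

(* Only the direction (cos h, sin h) can be asked to be continuous, since h
   jumps between -pi and pi; and only off the terminal states, where the
   direction to another player degenerates. *)
Definition continuous_feedback (h : state R -> R) : Prop :=
  feedback h /\
  forall x, ~~ captured x -> ~~ intercepted x ->
    {for x, continuous (fun y : state R => cos (h y))} /\
    {for x, continuous (fun y : state R => sin (h y))}.

Definition closed_loop phi chi psi z (t : R) : Prop :=
  is_derive t 1 (fun s => xT (z s)) (alpha * cos (phi (z t))) /\
  is_derive t 1 (fun s => yT (z s)) (alpha * sin (phi (z t))) /\
  is_derive t 1 (fun s => xA (z s)) (cos (chi (z t))) /\
  is_derive t 1 (fun s => yA (z s)) (sin (chi (z t))) /\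
  is_derive t 1 (fun s => xD (z s)) (cos (psi (z t))) /\
  is_derive t 1 (fun s => yD (z s)) (sin (psi (z t))).

(* A play from x stopped at the first time [tf] of contact of A with T or D,
   with [tf = +oo] when there is no contact. The motion solves the closed loop
   in the sense of Caratheodory: since speeds are at most 1, absolutely
   continuous solutions are exactly those that are 1-Lipschitz in each
   coordinate, which is what the sup norm of the product expresses. The values
   of [z] outside [0, tf] are irrelevant. *)
Definition play x phi chi psi z tf : Prop :=
  [/\ (0 <= tf)%E /\ z 0 = x,
      forall s t : R, 0 <= s -> s <= t -> (t%:E <= tf)%E ->
        `|z t - z s| <= t - s,
      {ae lebesgue_measure, forall t : R,
        0 < t -> (t%:E < tf)%E -> closed_loop phi chi psi z t},
      forall t : R, 0 <= t -> (t%:E < tf)%E ->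
        ~~ captured (z t) /\ ~~ intercepted (z t) &
      forall t : R, tf = t%:E -> captured (z t) || intercepted (z t)].

(* Strategies that do generate plays: a strategy with which no play exists
   would satisfy every payoff bound vacuously. *)
Definition team_playable x phi psi : Prop :=
  [/\ feedback phi, feedback psi &
      forall chi, continuous_feedback chi ->
        exists z tf, play x phi chi psi z tf].

Definition attacker_playable x chi : Prop :=
  feedback chi /\
  forall phi psi, continuous_feedback phi -> continuous_feedback psi ->
    exists z tf, play x phi chi psi z tf.

(* Terminal D-T distance when A captures T, possibly while being intercepted.
   If A is intercepted before, or if nothing ever happens, then the capture
   that A seeks does not occur, which is the worst outcome for A. *)
Definition cdg_payoff z tf : \bar R :=
  match tf with
  | t%:E => if captured (z t) then (dist (posD (z t)) (posT (z t)))%:E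
            else -oo%E
  | _ => -oo%E
  end.

(* Terminal A-T distance when D intercepts A, possibly while T is captured.
   If T is captured before any interception, it is the worst outcome for the
   team. If nothing ever happens, T survives, which is the worst outcome
   for A. *)
Definition atddg_payoff z tf : \bar R :=
  match tf with
  | t%:E => if intercepted (z t) then (dist (posA (z t)) (posT (z t)))%:E
            else -oo%E
  | _ => +oo%E
  end.

(* Payoffs J of the plays in which one side keeps to the given strategy; the
   other side uses any feedback, not necessarily a continuous one. *)
Definition team_outcomes (J : (R -> state R) -> \bar R -> \bar R) x phi psi :
    set (\bar R) :=
  [set v | exists chi z tf,
     [/\ feedback chi, play x phi chi psi z tf & v = J z tf]].

Definition attacker_outcomes (J : (R -> state R) -> \bar R -> \bar R) x chi :
    set (\bar R) :=
  [set v | exists phi psi z tf,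
     [/\ feedback phi, feedback psi, play x phi chi psi z tf & v = J z tf]].

Definition cdg_lower x : \bar R :=
  ereal_sup [set v | exists2 chi, attacker_playable x chi &
                       v = ereal_inf (attacker_outcomes cdg_payoff x chi)].
Definition cdg_upper x : \bar R :=
  ereal_inf [set v | exists phi psi, team_playable x phi psi /\
                       v = ereal_sup (team_outcomes cdg_payoff x phi psi)].
Definition atddg_lower x : \bar R :=
  ereal_sup [set v | exists phi psi, team_playable x phi psi /\
                       v = ereal_inf (team_outcomes atddg_payoff x phi psi)].
Definition atddg_upper x : \bar R :=
  ereal_inf [set v | exists2 chi, attacker_playable x chi &
                       v = ereal_sup (attacker_outcomes atddg_payoff x chi)].

Definition cdg_value x (V : R) : Prop :=
  cdg_lower x = V%:E /\ cdg_upper x = V%:E.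
Definition atddg_value x (V : R) : Prop :=
  atddg_lower x = V%:E /\ atddg_upper x = V%:E.

Definition playable_profile x phi chi psi : Prop :=
  [/\ team_playable x phi psi, attacker_playable x chi &
      exists z tf, play x phi chi psi z tf].

(* A maximizes. The two bounds force every play of the profile to yield V. *)
Definition cdg_saddle x phi chi psi (V : R) : Prop :=
  [/\ playable_profile x phi chi psi,
      ubound (team_outcomes cdg_payoff x phi psi) V%:E &
      lbound (attacker_outcomes cdg_payoff x chi) V%:E].

(* The team maximizes. *)
Definition atddg_saddle x phi chi psi (V : R) : Prop :=
  [/\ playable_profile x phi chi psi,
      lbound (team_outcomes atddg_payoff x phi psi) V%:E &
      ubound (attacker_outcomes atddg_payoff x chi) V%:E].

Definition cdg_optimal x phi chi psi : Prop :=
  exists2 V : R, cdg_value x V & cdg_saddle x phi chi psi V.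
Definition atddg_optimal x phi chi psi : Prop :=
  exists2 V : R, atddg_value x V & atddg_saddle x phi chi psi V.

End Plays.

(* Main.v *)
(* The common value is 0.  Both payoffs are distances, with -oo or +oo for the
   wrong ending, so each bound of a saddle point only says how plays end, and it
   says the same in both games: the team's bound means that every play that ends
   ends with D intercepting A, the Attacker's that every play ends in finite time
   with A capturing T.  Hence the games share their saddle points as soon as each
   side can enforce its bound.

   Let e = (T - A)/rho with rho = |T - A|, n = (A - D)/L with L = |A - D|, and
   k = e.n.  At every state, A heads along e - alpha n, T along alpha e - n and D
   along the mirror image of A's direction in the bisector of AD; these fields
   are continuous off the terminal states.  On the barrier all three directions
   point to the tangency point of the Apollonius disc with the bisector.  The
   margin
     G = rho L (k - alpha) + (1 - alpha^2)/2 L^2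
   vanishes on the barrier.  Against the team's strategy G' <= (2/l)|G| while
   L >= l, so G stays <= 0, which is incompatible with a capture at L > 0.  Against
   the Attacker's strategy G' >= -c |G| while rho is bounded below, so G stays
   >= 0, and an interception at rho > 0 would force G = 0 throughout and then
   L' >= -c L.  Finite duration: for Y = rho L (k - alpha), if Y is ever positive
   then (rho^2/Y)' <= -1/L and L grows at most linearly; otherwise k <= alpha
   always, and rho + c1 sqrt(-Y) decreases at a positive rate.

   Plays are only Lipschitz, so all this rests on: a Lipschitz function with
   nonnegative derivative almost everywhere is nondecreasing.  Plays exist by
   Peano's theorem: an ultrafilter limit of Euler step functions. *)
Require Import Defs.
From mathcomp Require Import all_boot all_order all_algebra.
From mathcomp Require Import all_classical all_reals all_analysis.
From mathcomp Require Import measurable_realfun.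
From mathcomp Require Import ring lra.

Set Implicit Arguments.
Unset Strict Implicit.
Unset Printing Implicit Defensive.

Import Order.TTheory GRing.Theory Num.Theory.
Import numFieldNormedType.Exports.

Local Open Scope classical_set_scope.
Local Open Scope ring_scope.

(** * Lipschitz functions and almost everywhere derivatives *)

Section RealAnalysis.
Variable R : realType.
Implicit Types (f g : R -> R) (a b t K l : R).

(** Without a quotient the case h = 0 is harmless, and a norm estimate on increments, such as the
    one in [peano], passes directly to each coordinate. *)
Lemma is_derive_epsP f t l :
  is_derive t 1 f l <->
  forall e, 0 < e -> exists2 d, 0 < d &
    forall h, `|h| < d -> `|f (t + h) - f t - l * h| <= e * `|h|.
Proof.
set F := fun h : R => h^-1 *: (f (h *: 1 + t) - f t).
have FE h : h != 0 -> `|f (t + h) - f t - l * h| = `|l - F h| * `|h|.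
  move=> h0; rewrite -normrM distrC /F /GRing.scale /= mulr1 (addrC h t).
  by congr (`|_|); field.
have lim_le : (F h @[h --> 0^'] --> l) <->
    forall e, 0 < e -> exists2 d, 0 < d &
      forall h, `|h| < d -> `|f (t + h) - f t - l * h| <= e * `|h|.
  split=> [/cvgrPdist_le Fl e e0|Fl].
    have /nbhs_ballP[d /= d0 Hd] := Fl e e0; exists d => // h hd.
    have [->|h0] := eqVneq h 0.
      by rewrite addr0 subrr mulr0 subrr normr0 mulr0.
    rewrite FE// ler_wpM2r//; apply: Hd => //.
    by rewrite /ball/= sub0r normrN.
  apply/cvgrPdist_le => e e0; have [d d0 Hd] := Fl e e0.
  apply/nbhs_ballP; exists d => //= h; rewrite /ball/= sub0r normrN => hd h0.
  by have := Hd _ hd; rewrite FE// ler_pM2r// normr_gt0.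
rewrite -lim_le; split=> [[df <-]|Fl]; first exact: df.
constructor; first by apply/cvg_ex; exists l.
exact: cvg_lim.
Qed.

(* With U open of measure < e around the exceptional null set, the function
   f t + e (t - a) + C mu(U `&` [a, t]) is locally nondecreasing to the right of
   every point: by the derivative outside U, by the Lipschitz bound inside. *)
Lemma nondecreasing_ae_derive f a b C :
  a <= b -> 0 <= C ->
  (forall s t : R, a <= s -> s <= t -> t <= b -> f s - C * (t - s) <= f t) ->
  {ae lebesgue_measure, forall t : R, a < t -> t < b ->
     exists2 l, is_derive t 1 f l & 0 <= l} ->
  f a <= f b.
Proof.
move=> ab C0 fC [N [mN N0 Nf]].
(* The endpoint a joins the exceptional set because the derivative hypothesis only concerns a <
   t. *)
pose A := N `|` [set a].
pose mu := @lebesgue_measure R.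
have mA : measurable A by apply: measurableU.
have A0 : mu A = 0%E.
  apply/eqP; rewrite eq_le measure_ge0 andbT.
  have mua : mu [set a] = 0%E by exact: lebesgue_measure_set1.
  apply: (@le_trans _ _ (mu N + mu [set a])%E); first exact: measureU2.
  by rewrite mua adde0 [mu N]N0.
(* Letting e tend to 0 concludes; dividing by b - a + C + 1 absorbs both error terms. *)
suff key e : 0 < e -> f a <= f b + e * (b - a) + C * e.
  apply/ler_addgt0Pr => e e0.
  have D0 : 0 < b - a + C + 1 by rewrite ltr_wpDl// addr_ge0// subr_ge0.
  have := key _ (divr_gt0 e0 D0) => /le_trans; apply.
  rewrite -addrA lerD2l (mulrC C) -mulrDr -mulrA ler_piMr// ?(ltW e0)//.
  by rewrite mulrC ler_pdivrMr// mul1r lerDl.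
move=> e0.
have [|U [oU AU Ue]] := @lebesgue_regularity_outer R A e mA _ e0.
  by rewrite [X in (X < _)%E]A0 ltry.
have mU : measurable U by exact: open_measurable.
have Ulte : (mu U < e%:E)%E.
  apply: le_lt_trans Ue; rewrite -[X in (mu X <= _)%E](setDUK AU).
  rewrite -[leRHS]add0e -A0; apply: measureU2 => //; exact: measurableD.
(* [ell] is the measure of U up to time t: it grows at unit speed while t runs inside U, yet never
   exceeds e. *)
pose ell t := fine (mu (U `&` `[a, t])).
have mUI t : measurable (U `&` `[a, t]) by exact: measurableI.
have mu_le X Y : measurable X -> measurable Y -> X `<=` Y -> (mu X <= mu Y)%E.
  by move=> mX mY XY; apply: le_measure => //; rewrite inE.
have UIU t : (mu (U `&` `[a, t]) <= mu U)%E.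
  exact: (mu_le _ _ (mUI t) mU (@subIsetl _ _ _)).
have ellE t : mu (U `&` `[a, t]) = (ell t)%:E.
  rewrite fineK// ge0_fin_numE//; apply: le_lt_trans (UIU t) _.
  exact: lt_trans Ulte (ltry _).
have ell0 t : 0 <= ell t by exact: fine_ge0.
have elle t : ell t <= e.
  by rewrite -lee_fin -ellE; exact: le_trans (UIU t) (ltW Ulte).
have ell_mono s t : s <= t -> ell s <= ell t.
  move=> st; rewrite -lee_fin -!ellE; apply: (mu_le _ _ (mUI s) (mUI t)).
  move=> x [Ux /=]; rewrite in_itv/= => /andP[ax xs]; split => //=.
  by rewrite in_itv/= ax (le_trans xs).
have ellU s t : a <= s -> s <= t -> `]s, t] `<=` U -> ell s + (t - s) <= ell t.
  move=> as_ st stU; rewrite -lee_fin EFinD -!ellE.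
  have <- : mu `]s, t]%classic = (t - s)%:E.
    rewrite /mu lebesgue_measure_itv /=; case: ltP => //.
    rewrite lee_fin => ts; have -> : t = s by apply/eqP; rewrite eq_le ts.
    by rewrite subrr.
  have <- : mu ((U `&` `[a, s]) `|` `]s, t]%classic) =
      (mu (U `&` `[a, s]) + mu `]s, t]%classic)%E.
    apply: measureU; [exact: mUI|exact: measurable_itv|].
    apply/seteqP; split => [x|x []//] [[_ /=]].
    rewrite !in_itv /= => /andP[_ xs] /andP[sx _].
    by move: (lt_le_trans sx xs); rewrite ltxx.
  apply: mu_le (mUI t) _.
    by apply: measurableU; [exact: mUI|exact: measurable_itv].
  move=> x [[Ux /=]|/= xst].
    rewrite in_itv/= => /andP[ax xs]; split => //=.
    by rewrite in_itv/= ax (le_trans xs).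
  split; first exact: stU.
  move: xst; rewrite /= !in_itv/= => /andP[sx ->]; rewrite andbT.
  exact: le_trans as_ (ltW sx).
pose g t := f t + e * (t - a) + C * ell t.
suff : g a <= g b.
  rewrite /g subrr mulr0 addr0 => gab.
  have : f a <= g b by apply: le_trans gab; rewrite lerDl mulr_ge0.
  by move=> /le_trans; apply; rewrite lerD2l ler_wpM2l.
(* The Lipschitz bound puts the supremum c of S into S. If c < b, growth of g just to the right of c
   contradicts the choice of c. *)
pose S := [set t | a <= t <= b /\ g a <= g t].
have Sa : S a by split; rewrite ?lexx.
have supS : has_sup S.
  by split; [exists a|exists b => x [/andP[]]].
set c := sup S.
have ac : a <= c by apply: sup_upper_bound.
have cb : c <= b by apply: sup_le_ub => [|x [/andP[]]]//; exists a.
have gc : g a <= g c.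
  apply/ler_addgt0Pr => d d0.
  have D0 : 0 < C + e + 1 by rewrite ltr_wpDl// addr_ge0// ltW.
  have [s [/andP[as_ sb] gs] cs] := sup_adherent (divr_gt0 d0 D0) supS.
  have sc : s <= c by apply: sup_upper_bound => //; split => //; apply/andP.
  apply: (le_trans gs); rewrite /g.
  have h1 := fC s c as_ sc cb.
  have h2 : C * ell s <= C * ell c by rewrite ler_wpM2l// ell_mono.
  have h3 : C * (c - s) <= d.
    have : (C + e + 1) * (c - s) < d.
      by rewrite mulrC -ltr_pdivlMr// ltrBlDr addrC -ltrBlDr.
    move=> /ltW; apply: le_trans; apply: ler_wpM2r; first by rewrite subr_ge0.
    by rewrite -addrA lerDl addr_ge0// ltW.
  have h4 : e * (s - a) <= e * (c - a) by rewrite ler_wpM2l ?(ltW e0)// lerB.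
  by lra.
have [//|cltb] : c = b \/ c < b.
  by move: cb; rewrite le_eqVlt => /orP[/eqP->|->]; [left|right].
  by move=> <-.
exfalso.
suff [t ct [tb gt]] : exists2 t, c < t & t <= b /\ g c <= g t.
  have : t <= c.
    apply: sup_upper_bound => //; split; last exact: le_trans gc gt.
    by rewrite tb (le_trans ac (ltW ct)).
  by rewrite leNgt ct.
(* Inside U, the possible loss C (t - c) of f is repaid by the growth of C [ell]. *)
have [Uc|Uc] := pselect (U c).
  have /nbhs_ballP[d /= d0 dU] := open_nbhs_nbhs (conj oU Uc).
  pose t := Num.min b (c + d / 2).
  have ct : c < t by rewrite lt_min cltb ltrDl divr_gt0.
  exists t => //; split; first by rewrite ge_min lexx.
  have h1 : ell c + (t - c) <= ell t.
    apply: ellU => //; first exact: ltW.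
    move=> x /=; rewrite in_itv/= => /andP[cx xt]; apply: dU.
    rewrite /ball/= distrC ger0_norm ?subr_ge0 ?(ltW cx)//.
    have : t <= c + d / 2 by rewrite ge_min lexx orbT.
    by move: xt; lra.
  have h2 := fC c t ac (ltW ct).
  have h3 : f c - C * (t - c) <= f t by apply: h2; rewrite ge_min lexx.
  have h4 : C * (ell c + (t - c)) <= C * ell t by rewrite ler_wpM2l.
  have h5 : e * (c - a) <= e * (t - a) by rewrite ler_wpM2l ?(ltW e0)// lerB// ltW.
  by rewrite /g; lra.
(* Outside U, c is an interior point with a nonnegative derivative, and the term e (t - a) covers
   the first-order error. *)
have altc : a < c.
  rewrite lt_neqAle ac andbT; apply/eqP => ca; apply: Uc; rewrite -ca.
  by apply: AU; right.
have Nc : ~ N c by move=> Nc; apply: Uc; apply: AU; left.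
have [l /is_derive_epsP Dl l0] : exists2 l, is_derive c 1 f l & 0 <= l.
  by apply: contrapT => Hc; apply/Nc/Nf => /= /(_ altc cltb).
have [d d0 Hd] := Dl e e0.
pose t := Num.min b (c + d / 2).
have ct : c < t by rewrite lt_min cltb ltrDl divr_gt0.
exists t => //; split; first by rewrite ge_min lexx.
have tc : t - c < d.
  have : t <= c + d / 2 by rewrite ge_min lexx orbT.
  by move: d0; lra.
have := Hd (t - c); rewrite ger0_norm ?subr_ge0 ?(ltW ct)// => /(_ tc).
rewrite (addrC c) subrK ler_norml => /andP[h1 _].
have h2 : 0 <= l * (t - c) by rewrite mulr_ge0// subr_ge0 ltW.
have h3 : C * ell c <= C * ell t by rewrite ler_wpM2l// ell_mono// ltW.
by rewrite /g; lra.
Qed.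

End RealAnalysis.

(** * Operations that preserve the Lipschitz property on an interval *)

Section LipschitzFunctions.
Variable R : realType.
Implicit Types (f g : R -> R) (a b t K l : R).

(** The constant is existentially quantified because the conclusions drawn from it below do not
    depend on its size. *)
Definition lip a b f := exists C : R, forall s t : R,
  a <= s -> s <= t -> t <= b -> `|f t - f s| <= C * (t - s).

Lemma lip_sub a b a' b' f : a <= a' -> b' <= b -> lip a b f -> lip a' b' f.
Proof.
move=> aa bb [C fC]; exists C => s t as_ st tb.
by apply: fC => //; [exact: le_trans as_|exact: le_trans bb].
Qed.

Lemma lip_ge0 a b f : lip a b f -> exists2 C : R, 0 <= C & forall s t : R,
  a <= s -> s <= t -> t <= b -> `|f t - f s| <= C * (t - s).
Proof.
move=> [C fC]; exists `|C| => // s t as_ st tb.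
by apply: (le_trans (fC s t as_ st tb)); rewrite ler_wpM2r ?subr_ge0// ler_norm.
Qed.

Lemma lip_bounded a b f : lip a b f ->
  exists2 M : R, 0 <= M & forall t, a <= t -> t <= b -> `|f t| <= M.
Proof.
move=> /lip_ge0[C C0 fC]; exists (`|f a| + C * `|b - a|).
  by rewrite addr_ge0// mulr_ge0.
move=> t at_ tb; have := fC a t (lexx _) at_ tb.
have h1 : `|f t| <= `|f a| + `|f t - f a|.
  by rewrite -{1}(subrKC (f a) (f t)) ler_normD.
have h2 : C * (t - a) <= C * `|b - a|.
  by apply: ler_wpM2l => //; apply: le_trans (ler_norm _); rewrite lerB.
by move: h1 h2; lra.
Qed.

Lemma lip_cst a b (c : R) : lip a b (fun=> c).
Proof. by exists 0 => s t *; rewrite subrr normr0 mul0r. Qed.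

Lemma lip_id a b : lip a b id.
Proof. by exists 1 => s t _ st _; rewrite mul1r ger0_norm// subr_ge0. Qed.

Lemma lipD a b f g : lip a b f -> lip a b g -> lip a b (fun t => f t + g t).
Proof.
move=> [C fC] [D gD]; exists (C + D) => s t as_ st tb.
have -> : f t + g t - (f s + g s) = (f t - f s) + (g t - g s) by ring.
by apply: le_trans (ler_normD _ _) _; rewrite mulrDl lerD ?fC ?gD.
Qed.

Lemma lipN a b f : lip a b f -> lip a b (fun t => - f t).
Proof.
move=> [C fC]; exists C => s t as_ st tb.
by rewrite -opprD normrN fC.
Qed.

Lemma lipB a b f g : lip a b f -> lip a b g -> lip a b (fun t => f t - g t).
Proof. by move=> fl gl; apply: lipD => //; exact: lipN. Qed.

Lemma lipM a b f g : lip a b f -> lip a b g -> lip a b (fun t => f t * g t).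
Proof.
move=> fl gl; have [M M0 fM] := lip_bounded fl.
have [N N0 gN] := lip_bounded gl.
have [C C0 fC] := lip_ge0 fl; have [D D0 gD] := lip_ge0 gl.
exists (M * D + N * C) => s t as_ st tb.
have -> : f t * g t - f s * g s = f t * (g t - g s) + g s * (f t - f s) by ring.
apply: (le_trans (ler_normD _ _)); rewrite mulrDl !normrM -!mulrA.
have at_ := le_trans as_ st; have sb := le_trans st tb.
by apply: lerD; apply: ler_pM => //; [exact: fM|exact: gD|exact: gN|exact: fC].
Qed.

Lemma lipX2 a b f : lip a b f -> lip a b (fun t => f t ^+ 2).
Proof.
move=> fl; rewrite (_ : (fun t => f t ^+ 2) = fun t => f t * f t).
  exact: lipM.
by apply/funext => t; rewrite expr2.
Qed.

(** The bound on h is asked only at values taken by f, so that it applies to the inverse, the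
    logarithm and the square root, which are Lipschitz away from 0 only. *)
Lemma lip_comp a b f (h : R -> R) (D : R) :
  (forall s t, a <= s <= b -> a <= t <= b ->
     `|h (f t) - h (f s)| <= D * `|f t - f s|) ->
  lip a b f -> lip a b (fun t => h (f t)).
Proof.
move=> hD /lip_ge0[C C0 fC]; exists (`|D| * C) => s t as_ st tb.
have at_ := le_trans as_ st; have sb := le_trans st tb.
apply: (le_trans (hD _ _ _ _)); rewrite ?as_ ?sb ?at_ ?tb// -mulrA.
apply: (@le_trans _ _ (`|D| * `|f t - f s|)); first by rewrite ler_wpM2r// ler_norm.
by rewrite ler_wpM2l// fC.
Qed.

Lemma lipV a b f (d : R) : 0 < d -> (forall t, a <= t -> t <= b -> d <= f t) ->
  lip a b f -> lip a b (fun t => (f t)^-1).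
Proof.
move=> d0 df; apply: (@lip_comp a b f GRing.inv (d ^- 2)) => s t /andP[as_ sb] /andP[at_ tb].
have fs := df s as_ sb; have ft := df t at_ tb.
have fs0 := lt_le_trans d0 fs; have ft0 := lt_le_trans d0 ft.
have -> : (f t)^-1 - (f s)^-1 = (f t * f s)^-1 * - (f t - f s).
  by field; rewrite !gt_eqF.
rewrite normrM normrN ler_wpM2r// gtr0_norm ?invr_gt0 ?mulr_gt0//.
by rewrite lef_pV2 ?posrE ?mulr_gt0// ?exprn_gt0// expr2 ler_pM// ltW.
Qed.

Lemma lip_ln a b f (d : R) : 0 < d -> (forall t, a <= t -> t <= b -> d <= f t) ->
  lip a b f -> lip a b (fun t => ln (f t)).
Proof.
move=> d0 df; apply: (@lip_comp a b f (@ln R) d^-1).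
have key x y : d <= x -> x <= y -> `|ln y - ln x| <= d^-1 * (y - x).
  move=> dx xy; have x0 := lt_le_trans d0 dx; have y0 := lt_le_trans x0 xy.
  rewrite ger0_norm ?subr_ge0 ?ler_ln ?posrE// -ln_div ?posrE//.
  have yx : y / x = 1 + (y - x) / x by field; rewrite gt_eqF.
  rewrite yx; apply: (le_trans (le_ln1Dx _)).
    by rewrite (@lt_le_trans _ _ 0) ?ltrN10// divr_ge0 ?subr_ge0// ltW.
  by rewrite mulrC ler_wpM2r ?subr_ge0// lef_pV2 ?posrE.
move=> s t /andP[as_ sb] /andP[at_ tb].
have [st|/ltW st] := leP (f s) (f t).
  by rewrite [X in _ <= _ * X]ger0_norm ?subr_ge0// key// df.
by rewrite distrC (distrC (f t)) [X in _ <= _ * X]ger0_norm ?subr_ge0// key// df.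
Qed.

Lemma lip_sqrt a b f (d : R) : 0 < d -> (forall t, a <= t -> t <= b -> d <= f t) ->
  lip a b f -> lip a b (fun t => Num.sqrt (f t)).
Proof.
move=> d0 df; apply: (@lip_comp a b f Num.sqrt (Num.sqrt d)^-1).
move=> s t /andP[as_ sb] /andP[at_ tb].
have ds := df s as_ sb; have dt := df t at_ tb.
have sd0 : 0 < Num.sqrt d by rewrite sqrtr_gt0.
have fs0 := le_trans (ltW d0) ds; have ft0 := le_trans (ltW d0) dt.
have h : Num.sqrt d <= Num.sqrt (f t) by rewrite ler_wsqrtr.
rewrite mulrC ler_pdivlMr//.
rewrite -{2}(sqr_sqrtr fs0) -{2}(sqr_sqrtr ft0) subr_sqr normrM.
by rewrite ler_wpM2l// ger0_norm ?addr_ge0// (le_trans h)// lerDl.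
Qed.

Lemma lip_expR a b (K : R) : lip a b (fun t => expR (K * t)).
Proof.
have fl : lip a b (fun t => K * t) by apply: lipM; [exact: lip_cst|exact: lip_id].
have [M M0 fM] := lip_bounded fl.
apply: (@lip_comp a b (fun t => K * t) expR (expR M)) => //.
have key x y : y <= M -> x <= y -> `|expR y - expR x| <= expR M * (y - x).
  move=> yM xy; rewrite ger0_norm ?subr_ge0 ?ler_expR//.
  have -> : expR y - expR x = expR y * (1 - expR (x - y)).
    by rewrite mulrBr -expRD mulr1; congr (_ - expR _); ring.
  apply: ler_pM => //; rewrite ?expR_ge0 ?ler_expR//.
    by rewrite subr_ge0 -expR0 ler_expR subr_le0.
  by have := expR_ge1Dx (x - y); lra.
move=> s t /andP[as_ sb] /andP[at_ tb].
have [st|/ltW st] := leP (K * s) (K * t).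
  rewrite [X in _ <= _ * X]ger0_norm ?subr_ge0// key//.
  by rewrite (le_trans (ler_norm _))// fM.
rewrite distrC (distrC (K * t)) [X in _ <= _ * X]ger0_norm ?subr_ge0// key//.
by rewrite (le_trans (ler_norm _))// fM.
Qed.

(** After squaring, the cross terms are absorbed because each coordinate is bounded by the norm.
    Contrary to [lip_sqrt], no distance from 0 is required, so that [rho] and [sep] are Lipschitz up
    to contact. *)
Lemma sqrt_sum_sq_dist (x y x' y' : R) :
  `|Num.sqrt (x ^+ 2 + y ^+ 2) - Num.sqrt (x' ^+ 2 + y' ^+ 2)| <=
  `|x - x'| + `|y - y'|.
Proof.
have tri (p q p' q' : R) : Num.sqrt (p ^+ 2 + q ^+ 2) <=
    Num.sqrt (p' ^+ 2 + q' ^+ 2) + (`|p - p'| + `|q - q'|).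
  have s0 : 0 <= p' ^+ 2 + q' ^+ 2 by rewrite addr_ge0// sqr_ge0.
  set S := Num.sqrt (p' ^+ 2 + q' ^+ 2).
  have S2 : S ^+ 2 = p' ^+ 2 + q' ^+ 2 by rewrite sqr_sqrtr.
  have S0 : 0 <= S by exact: sqrtr_ge0.
  have r0 : 0 <= S + (`|p - p'| + `|q - q'|) by rewrite !addr_ge0.
  rewrite -(ger0_norm r0) -sqrtr_sqr ler_wsqrtr//.
  have pS : `|p'| <= S.
    by rewrite -sqrtr_sqr ler_wsqrtr// lerDl sqr_ge0.
  have qS : `|q'| <= S.
    by rewrite -sqrtr_sqr ler_wsqrtr// lerDr sqr_ge0.
  have h1 : p' * (p - p') <= S * `|p - p'|.
    by apply: (le_trans (ler_norm _)); rewrite normrM ler_wpM2r.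
  have h2 : q' * (q - q') <= S * `|q - q'|.
    by apply: (le_trans (ler_norm _)); rewrite normrM ler_wpM2r.
  have n1 : (p - p') ^+ 2 = `|p - p'| ^+ 2 by rewrite real_normK// num_real.
  have n2 : (q - q') ^+ 2 = `|q - q'| ^+ 2 by rewrite real_normK// num_real.
  have n3 : 0 <= `|p - p'| * `|q - q'| by rewrite mulr_ge0.
  have -> : p ^+ 2 + q ^+ 2 = p' ^+ 2 + q' ^+ 2 + 2 * (p' * (p - p'))
    + 2 * (q' * (q - q')) + (p - p') ^+ 2 + (q - q') ^+ 2 by ring.
  have -> : (S + (`|p - p'| + `|q - q'|)) ^+ 2 = S ^+ 2 + 2 * (S * `|p - p'|)
    + 2 * (S * `|q - q'|) + `|p - p'| ^+ 2 + `|q - q'| ^+ 2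
    + 2 * (`|p - p'| * `|q - q'|) by ring.
  by rewrite S2 n1 n2; lra.
rewrite ler_norml; apply/andP; split.
  by have := tri x' y' x y; rewrite (distrC x') (distrC y'); lra.
by have := tri x y x' y'; lra.
Qed.

Lemma lip_hypot a b f g : lip a b f -> lip a b g ->
  lip a b (fun t => Num.sqrt (f t ^+ 2 + g t ^+ 2)).
Proof.
move=> [C fC] [D gD]; exists (C + D) => s t as_ st tb.
apply: (le_trans (sqrt_sum_sq_dist _ _ _ _)).
by rewrite mulrDl lerD ?fC ?gD.
Qed.

End LipschitzFunctions.

(** * Differentiation rules, with derivatives written as field expressions *)

Section Derivatives.
Variable R : realType.
Implicit Types (f g : R -> R) (t l m : R).

Lemma derM f g t l m : is_derive t 1 f l -> is_derive t 1 g m ->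
  is_derive t 1 (fun s => f s * g s) (l * g t + f t * m).
Proof.
move=> fl gm; apply: (is_derive_eq (is_deriveM fl gm)).
by rewrite /GRing.scale/= addrC mulrC (mulrC l).
Qed.

Lemma derD f g t l m : is_derive t 1 f l -> is_derive t 1 g m ->
  is_derive t 1 (fun s => f s + g s) (l + m).
Proof. by move=> fl gm; exact: is_deriveD. Qed.

Lemma derB f g t l m : is_derive t 1 f l -> is_derive t 1 g m ->
  is_derive t 1 (fun s => f s - g s) (l - m).
Proof. by move=> fl gm; exact: is_deriveB. Qed.

Lemma derC t (c : R) : is_derive t 1 (fun=> c) 0.
Proof. exact: is_derive_cst. Qed.

Lemma derZ f t l (c : R) : is_derive t 1 f l ->
  is_derive t 1 (fun s => c * f s) (c * l).
Proof.
by move=> fl; apply: (is_derive_eq (derM (derC t c) fl)); rewrite mul0r add0r.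
Qed.

Lemma derV f t l : f t != 0 -> is_derive t 1 f l ->
  is_derive t 1 (fun s => (f s)^-1) (- l / f t ^+ 2).
Proof.
move=> f0 fl; apply: (is_derive_eq (is_deriveV f0 fl)).
by rewrite /GRing.scale/= mulrC mulrN mulNr.
Qed.

Lemma der_sqrt f t l : 0 < f t -> is_derive t 1 f l ->
  is_derive t 1 (fun s => Num.sqrt (f s)) (l / (2 * Num.sqrt (f t))).
Proof.
move=> f0 fl.
apply: (is_derive_eq (is_derive1_comp (is_derive1_sqrt f0) fl)).
by rewrite mulrC.
Qed.

Lemma der_ln f t l : 0 < f t -> is_derive t 1 f l ->
  is_derive t 1 (fun s => ln (f s)) (l / f t).
Proof.
move=> f0 fl.
apply: (is_derive_eq (is_derive1_comp (is_derive1_ln f0) fl)).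
by rewrite mulrC.
Qed.

Lemma der_expR t (K : R) : is_derive t 1 (fun s => expR (K * s)) (K * expR (K * t)).
Proof.
have h : is_derive t 1 (fun s => K * s) K.
  by apply: (is_derive_eq (derZ K (is_derive_id t 1))); rewrite mulr1.
apply: (is_derive_eq (is_derive1_comp (is_derive_expR _) h)).
by rewrite mulrC.
Qed.

Lemma der_hypot f g t l m : 0 < f t ^+ 2 + g t ^+ 2 ->
  is_derive t 1 f l -> is_derive t 1 g m ->
  is_derive t 1 (fun s => Num.sqrt (f s ^+ 2 + g s ^+ 2))
    ((f t * l + g t * m) / Num.sqrt (f t ^+ 2 + g t ^+ 2)).
Proof.
move=> fg0 fl gm.
have h : is_derive t 1 (fun s => f s ^+ 2 + g s ^+ 2) (2 * (f t * l + g t * m)).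
  rewrite (_ : (fun s => _) = fun s => f s * f s + g s * g s); last first.
    by apply/funext => s; rewrite !expr2.
  by apply: (is_derive_eq (derD (derM fl fl) (derM gm gm))); ring.
apply: (is_derive_eq (@der_sqrt (fun s => f s ^+ 2 + g s ^+ 2) t _ fg0 h)).
by field; rewrite gt_eqF// sqrtr_gt0.
Qed.

Lemma derX2 f t l : is_derive t 1 f l ->
  is_derive t 1 (fun s => f s ^+ 2) (2 * f t * l).
Proof.
move=> fl; rewrite (_ : (fun s => _) = fun s => f s * f s); last first.
  by apply/funext => s; rewrite !expr2.
by apply: (is_derive_eq (derM fl fl)); ring.
Qed.

End Derivatives.

(** * Comparison principles of Gronwall type for Lipschitz functions *)

Section Comparison.
Variable R : realType.
Implicit Types (f g : R -> R) (a b t K l : R).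

Lemma ae_imply (P Q : R -> Prop) : (forall t, P t -> Q t) ->
  {ae lebesgue_measure, forall t : R, P t} ->
  {ae lebesgue_measure, forall t : R, Q t}.
Proof. by move=> PQ; apply: negligibleS => t /= nQ /PQ. Qed.

Lemma lip_ae_nondecreasing f a b : a <= b -> lip a b f ->
  {ae lebesgue_measure, forall t : R, a < t -> t < b ->
     exists2 l, is_derive t 1 f l & 0 <= l} ->
  f a <= f b.
Proof.
move=> ab /lip_ge0[C C0 fC]; apply: (@nondecreasing_ae_derive _ _ _ _ C) => //.
move=> s t as_ st tb; have := fC s t as_ st tb.
by rewrite ler_norml => /andP[+ _]; lra.
Qed.

(** After the last time c with f c >= 0 the function is negative, hence has a nonnegative derivative
    almost everywhere and cannot descend from f c. *)
Lemma lip_ae_ge0 f a b : a <= b -> lip a b f -> 0 <= f a ->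
  {ae lebesgue_measure, forall t : R, a < t -> t < b -> f t < 0 ->
     exists2 l, is_derive t 1 f l & 0 <= l} ->
  0 <= f b.
Proof.
move=> ab fl fa0 df; have [C C0 fC] := lip_ge0 fl.
rewrite leNgt; apply/negP => fb0.
pose S := [set t | a <= t <= b /\ 0 <= f t].
have Sa : S a by split; rewrite ?lexx.
have supS : has_sup S by split; [exists a|exists b => x [/andP[]]].
set c := sup S.
have ac : a <= c by apply: sup_upper_bound.
have cb : c <= b by apply: sup_le_ub => [|x [/andP[]]]//; exists a.
have fc0 : 0 <= f c.
  apply/ler_addgt0Pr => d d0.
  have D0 : 0 < C + 1 by rewrite ltr_wpDl.
  have [s [/andP[as_ sb] gs] cs] := sup_adherent (divr_gt0 d0 D0) supS.
  have sc : s <= c by apply: sup_upper_bound => //; split => //; apply/andP.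
  have := fC s c as_ sc cb; rewrite ler_norml => /andP[h1 _].
  have : (C + 1) * (c - s) < d.
    by rewrite mulrC -ltr_pdivlMr// ltrBlDr addrC -ltrBlDr.
  by move: h1 gs sc; lra.
have : f c <= f b.
  apply: lip_ae_nondecreasing => //; first exact: lip_sub fl.
  apply: ae_imply df => t dft ct tb; apply: dft => //; first exact: le_lt_trans ct.
  rewrite ltNge; apply/negP => ft0.
  have : t <= c.
    by apply: sup_upper_bound => //; split => //; rewrite (ltW tb) (le_trans ac (ltW ct)).
  by rewrite leNgt ct.
by rewrite leNgt (lt_le_trans fb0).
Qed.

(** Where f < 0 the bound reads l >= K f, so that f exp(- K t) has a nonnegative derivative there,
    which is all that [lip_ae_ge0] asks. *)
Lemma gronwall_ge0 f a b K : a <= b -> lip a b f -> 0 <= f a ->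
  {ae lebesgue_measure, forall t : R, a < t -> t < b ->
     exists2 l, is_derive t 1 f l & - K * `|f t| <= l} ->
  0 <= f b.
Proof.
move=> ab fl fa0 df.
have : 0 <= f b * expR (- K * b).
  apply: (@lip_ae_ge0 (fun t => f t * expR (- K * t)) a b ab).
  - by apply: lipM => //; exact: lip_expR.
  - by rewrite mulr_ge0// expR_ge0.
  apply: ae_imply df => t dft at_ tb; have [l Dl Kl] := dft at_ tb.
  rewrite pmulr_llt0 ?expR_gt0// => ft0.
  exists ((l - K * f t) * expR (- K * t)).
    by apply: (is_derive_eq (derM Dl (der_expR t (- K)))); ring.
  by rewrite mulr_ge0 ?expR_ge0//; move: Kl; rewrite ltr0_norm//; lra.
by rewrite pmulr_lge0// expR_gt0.
Qed.

(** Once f >= 0 is known the bound reads l >= - K f, so that f exp(K t) is nondecreasing and keeps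
    its positive initial value as a lower bound. *)
Lemma gronwall_gt0 f a b K : a <= b -> lip a b f -> 0 < f a ->
  {ae lebesgue_measure, forall t : R, a < t -> t < b ->
     exists2 l, is_derive t 1 f l & - K * `|f t| <= l} ->
  0 < f b.
Proof.
move=> ab fl fa0 df.
have f0 t : a <= t -> t <= b -> 0 <= f t.
  move=> at_ tb; apply: (@gronwall_ge0 f a t K) => //; first exact: lip_sub fl.
    exact: ltW.
  by apply: ae_imply df => s dfs as_ st; apply: dfs => //; exact: lt_le_trans tb.
have : f a * expR (K * a) <= f b * expR (K * b).
  apply: (@lip_ae_nondecreasing (fun t => f t * expR (K * t))) => //.
    by apply: lipM => //; exact: lip_expR.
  apply: ae_imply df => t dft at_ tb; have [l Dl Kl] := dft at_ tb.
  exists ((l + K * f t) * expR (K * t)).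
    by apply: (is_derive_eq (derM Dl (der_expR t K))); ring.
  rewrite mulr_ge0 ?expR_ge0//; move: Kl.
  by rewrite ger0_norm ?f0 ?(ltW at_) ?(ltW tb)//; lra.
move=> h; have : 0 < f b * expR (K * b).
  by apply: lt_le_trans h; rewrite mulr_gt0// expR_gt0.
by rewrite pmulr_lgt0// expR_gt0.
Qed.

End Comparison.

(** * Existence of plays *)

Section Peano.
Variables (R : realType) (V : normedModType R).

(** Compactness gives a cluster point; an ultrafilter contains each neighbourhood of it or the
    complement, and the complement is excluded. *)
Lemma ultra_compact_cvg (U : set_system nat) (u : nat -> V) (A : set V) :
  UltraFilter U -> compact A -> (forall n, A (u n)) ->
  exists l : V, u @ U --> l.
Proof.
move=> UU cA Au.
have PU : ProperFilter U by exact: ultra_proper.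
have [|l [_ cl]] := cA (u @ U) _.
  by apply: (@filterS _ U _ setT) => [n _|]; [exact: Au|exact: filterT].
exists l => N lN.
have [//|UN] := in_ultra_setVsetC (u @^-1` N) UU.
have UN' : (u @ U) (~` N) by exact: UN.
by have [y [Ny /= ]] := cl _ _ UN' lN.
Qed.

Variables (f : V -> V) (x : V).
Hypothesis f1 : forall y, `|f y| <= 1.

Fixpoint euler (h : R) (k : nat) : V :=
  if k is k'.+1 then euler h k' + h *: f (euler h k') else x.

(** With v = 0 and e = 1 this is the Lipschitz bound of the Euler points; with v = f (z t) it yields
    the derivative of the limit at t. *)
Lemma euler_increment (h e : R) (v : V) i k : 0 <= h ->
  (forall j, (i <= j < i + k)%N -> `|f (euler h j) - v| <= e) ->
  `|euler h (i + k) - euler h i - (h *+ k) *: v| <= e * (h *+ k).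
Proof.
move=> h0; elim: k => [_|k IH fv].
  by rewrite addn0 subrr mulr0n scale0r subrr normr0 mulr0.
rewrite addnS /= mulrSr mulrDr.
have -> : euler h (i + k) + h *: f (euler h (i + k)) - euler h i -
    (h *+ k + h) *: v =
    (euler h (i + k) - euler h i - (h *+ k) *: v) + h *: (f (euler h (i + k)) - v).
  by rewrite scalerDl scalerBr opprD [in RHS]addrACA (addrAC (euler h (i + k))).
apply: (le_trans (ler_normD _ _)); apply: lerD.
  by apply: IH => j /andP[ij jk]; apply: fv; rewrite ij addnS ltnS ltnW.
rewrite normrZ ger0_norm// mulrC ler_wpM2r// fv//.
by rewrite leq_addr addnS ltnSn.
Qed.

Lemma euler_lip (h : R) i k : 0 <= h ->
  `|euler h (i + k) - euler h i| <= h *+ k.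
Proof.
move=> h0; have := @euler_increment h 1 0 i k h0.
by rewrite scaler0 subr0 mul1r; apply => j _; rewrite subr0.
Qed.

Hypothesis compact_ball : forall M : R, compact [set y : V | `|y| <= M].

(* z t is the limit of the Euler step functions along a free ultrafilter;
   pointwise convergence is enough since they are uniformly almost 1-Lipschitz. *)
Lemma peano : exists z : R -> V,
  [/\ z 0 = x,
      forall s t : R, 0 <= s -> s <= t -> `|z t - z s| <= t - s &
      forall t : R, 0 < t -> {for z t, continuous f} ->
        forall e, 0 < e -> exists2 d, 0 < d & forall h, `|h| < d ->
          `|z (t + h) - z t - h *: f (z t)| <= e * `|h|].
Proof.
pose h n : R := n.+1%:R^-1.
have h0 n : 0 < h n by rewrite invr_gt0 ltr0n.
(* [k n t] is the index of the last grid point not after t. *)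
pose k n (t : R) : nat := Num.truncn (t / h n).
have kP n t : 0 <= t -> (h n *+ k n t <= t) /\ (t < h n *+ k n t + h n).
  move=> t0; have /truncn_itv/andP[] : 0 <= t / h n by rewrite divr_ge0// ltW.
  rewrite ler_pdivlMr// ltr_pdivrMr// -/(k n t) -natr1 mulrDl mul1r.
  by rewrite mulr_natl.
have kle n s t : 0 <= s -> s <= t -> (k n s <= k n t)%N.
  move=> s0 st; rewrite /k; apply: le_truncn; apply: ler_wpM2r => //.
  by rewrite invr_ge0 ltW.
pose u t n := euler (h n) (k n t).
(* Rounding both times to the grid costs at most one step [h n], which vanishes in the limit. *)
have ksub n s t : 0 <= s -> s <= t ->
    `|h n *+ (k n t - k n s) - (t - s)| <= h n.
  move=> s0 st; have [a1 a2] := kP n s s0.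
  have [b1 b2] := kP n t (le_trans s0 st).
  rewrite mulrnBr ?kle// ler_norml; apply/andP; split; lra.
have ulip n s t : 0 <= s -> s <= t -> `|u t n - u s n| <= t - s + h n.
  move=> s0 st; rewrite /u -{1}(subnKC (kle n s t s0 st)).
  apply: (le_trans (euler_lip _ _ (ltW (h0 n)))).
  by have := ksub n s t s0 st; rewrite ler_norml => /andP[_]; lra.
have [U [UU Uoo]] := ultraFilterLemma (@eventually_filter).
have PU : ProperFilter U by exact: ultra_proper.
have k0 n : k n 0 = 0%N by rewrite /k mul0r truncn0.
have uU t : 0 <= t -> exists l : V, u t @ U --> l.
  move=> t0; have CB := @compact_ball (`|x| + t + 1).
  apply: (@ultra_compact_cvg U (u t) _ UU CB) => n /=.
  have := ulip n 0 t (lexx 0) t0; rewrite /u k0 /= subr0.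
  have h1 : h n <= 1 by rewrite invf_le1 ?ltr0n// ler1n.
  have := ler_normD (euler (h n) (k n t) - x) x; rewrite subrK.
  by move: h1; lra.
have /choice[z zP] : forall t, exists l : V, 0 <= t -> u t @ U --> l.
  move=> t; have [t0|t0] := leP 0 t; last by exists x.
  by have [l] := uU t t0; exists l.
have near_h (e : R) : 0 < e -> U [set n | h n < e].
  move=> e0; apply: Uoo.
  have /cvgrPdist_lt/(_ e e0) := @cvg_harmonic R.
  apply: filterS => n /=; rewrite sub0r normrN gtr0_norm//; exact: h0.
have near_u (t e : R) : 0 <= t -> 0 < e -> U [set n | `|z t - u t n| < e].
  by move=> t0 e0; have /cvgrPdist_lt/(_ e e0) := zP t t0.
exists z; split.
- apply/eqP; rewrite -subr_eq0 -normr_le0; apply/ler_addgt0Pr => e e0.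
  have [n /=] := filter_ex (near_u 0 e (lexx 0) e0).
  by rewrite /u k0 /= add0r; exact: ltW.
- move=> s t s0 st; have t0 := le_trans s0 st.
  apply/ler_addgt0Pr => e e0; have e30 : 0 < e / 3 by lra.
  have [n [[/= n1 n2] n3]] := filter_ex
    (filterI (filterI (near_u t _ t0 e30) (near_u s _ s0 e30)) (near_h _ e30)).
  have := ulip n s t s0 st.
  have -> : z t - z s = (z t - u t n) + (u t n - u s n) - (z s - u s n).
    by rewrite [X in _ = X - _]addrA subrK opprB addrA subrK.
  have := ler_normB ((z t - u t n) + (u t n - u s n)) (z s - u s n).
  have := ler_normD (z t - u t n) (u t n - u s n).
  by move: n1 n2 n3; lra.
move=> t t0 ft e e0.
have /cvgrPdist_le/(_ e e0)/nbhs_normP[d /= d0 fd] := ft.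
(* Taking t as either endpoint of [r, s] covers increments of both signs. *)
have claim r s : 0 <= r -> r <= s -> s - r < d / 2 -> t = r \/ t = s ->
    `|z s - z r - (s - r) *: f (z t)| <= e * (s - r).
  move=> r0 rs srd trs; have s0 := le_trans r0 rs.
  apply/ler_addgt0Pr => eta eta0.
  (* The errors are c for each limit at r and s, c for the rounding and e c for its effect on the
     slope: together at most eta. The bound d / 4 keeps the Euler points used within d of z t. *)
  pose c := Num.min (d / 4) (eta / (4 * (1 + e))).
  have c0 : 0 < c.
    by rewrite lt_min !divr_gt0//= ?mulr_gt0// addr_gt0.
  have cd : c <= d / 4 by rewrite ge_min lexx.
  have ce : c * (4 * (1 + e)) <= eta.
    by rewrite -ler_pdivlMr ?mulr_gt0// ?addr_gt0// ge_min lexx orbT.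
  have [n [[[/= n1 n2] n3] n4]] := filter_ex (filterI (filterI (filterI
    (near_u r _ r0 c0) (near_u s _ s0 c0)) (near_u t _ (ltW t0) c0)) (near_h _ c0)).
  have krs := kle n r s r0 rs.
  set N := (k n s - k n r)%N.
  have hN := ksub n r s r0 rs; rewrite -/N ler_norml in hN.
  have /andP[hN1 hN2] := hN.
  have ksN : k n s = (k n r + N)%N by rewrite /N subnKC.
  have fj j : (k n r <= j < k n r + N)%N -> `|f (euler (h n) j) - f (z t)| <= e.
    move=> /andP[j1 j2]; rewrite distrC; apply: fd.
    have jt : `|euler (h n) j - u t n| <= h n *+ N.
      have hh i i' : (i <= i')%N -> (i' - i <= N)%N ->
          `|euler (h n) i' - euler (h n) i| <= h n *+ N.
        move=> ii iN; rewrite -{1}(subnKC ii).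
        apply: (le_trans (euler_lip _ _ (ltW (h0 n)))).
        by apply: ler_wpMn2l => //; exact: ltW.
      rewrite /u; case: trs => ->.
        by apply: hh => //; rewrite leq_subLR ltnW.
      rewrite distrC; apply: hh; first by rewrite ksN ltnW.
      by rewrite ksN leq_subLR leq_add2r.
    rewrite /ball_/=.
    have -> : z t - euler (h n) j = (z t - u t n) - (euler (h n) j - u t n).
      by rewrite opprB addrA subrK.
    have := ler_normB (z t - u t n) (euler (h n) j - u t n).
    by move: jt n3 hN2 srd cd n4; lra.
  have := euler_increment (ltW (h0 n)) fj; rewrite -ksN => inc.
  have -> : z s - z r - (s - r) *: f (z t) =
     ((z s - u s n) - (z r - u r n)) +
     ((u s n - u r n - (h n *+ N) *: f (z t)) +
      (h n *+ N - (s - r)) *: f (z t)).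
    rewrite [X in _ = _ + (_ + X)]scalerBl [X in _ = _ + X]addrA subrK opprB addrA.
    have -> : z s - u s n + (u r n - z r) = z s - z r - (u s n - u r n).
      by rewrite opprB (addrC (u r n) (- z r)) addrACA (addrC (- u s n)).
    by rewrite subrK.
  have a1 := ler_normD ((z s - u s n) - (z r - u r n))
     ((u s n - u r n - (h n *+ N) *: f (z t)) +
      (h n *+ N - (s - r)) *: f (z t)).
  have a2 := ler_normB (z s - u s n) (z r - u r n).
  have a3 := ler_normD (u s n - u r n - (h n *+ N) *: f (z t))
      ((h n *+ N - (s - r)) *: f (z t)).
  have a4 : `|(h n *+ N - (s - r)) *: f (z t)| <= h n.
    rewrite normrZ -[leRHS]mulr1; apply: ler_pM => //; exact: ksub.
  have a5 : e * (h n *+ N) <= e * (s - r) + e * c.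
    by rewrite -mulrDr ler_wpM2l ?(ltW e0)//; lra.
  rewrite -/(u s n) -/(u r n) in inc.
  have a6 : 0 <= c * e by rewrite mulr_ge0 ?ltW.
  by move: a1 a2 a3 a4 a5 a6 inc n1 n2 n4 ce => /=; lra.
(* The radius is at most t because z is controlled at nonnegative times only. *)
exists (Num.min (d / 2) t); first by rewrite lt_min t0 divr_gt0.
move=> y; rewrite lt_min => /andP[yd yt].
have [y0|y0] := leP 0 y.
  have ty : t + y - t = y by rewrite addrC addKr.
  rewrite ger0_norm// in yd yt *; have := @claim t (t + y).
  by rewrite ty; apply; rewrite ?(ltW t0)// ?lerDl//; left.
rewrite ltr0_norm// in yd yt *; have := @claim (t + y) t.
have -> : t - (t + y) = - y by rewrite opprD addrA subrr add0r.
move=> /(_ _ _ yd _) H.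
have -> : z (t + y) - z t - y *: f (z t) = - (z t - z (t + y) - - y *: f (z t)).
  by rewrite scaleNr opprK opprD opprB.
by rewrite normrN; apply: H; [lra|lra|right].
Qed.

End Peano.

(** * Existence of plays under continuous feedbacks *)

Section PlayExistence.
Variables (R : realType) (alpha : R).
Implicit Types x y : state R.

Lemma norm_fst (U V : normedModType R) (p : U * V) : `|p.1| <= `|p|.
Proof. by rewrite prod_normE le_max lexx. Qed.

Lemma norm_snd (U V : normedModType R) (p : U * V) : `|p.2| <= `|p|.
Proof. by rewrite prod_normE le_max lexx orbT. Qed.

Lemma norm_xT y : `|xT y| <= `|y|.
Proof. exact: le_trans (norm_fst _) (le_trans (norm_fst _) (norm_fst _)). Qed.
Lemma norm_yT y : `|yT y| <= `|y|.
Proof. exact: le_trans (norm_snd _) (le_trans (norm_fst _) (norm_fst _)). Qed.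
Lemma norm_xA y : `|xA y| <= `|y|.
Proof. exact: le_trans (norm_fst _) (le_trans (norm_snd _) (norm_fst _)). Qed.
Lemma norm_yA y : `|yA y| <= `|y|.
Proof. exact: le_trans (norm_snd _) (le_trans (norm_snd _) (norm_fst _)). Qed.
Lemma norm_xD y : `|xD y| <= `|y|.
Proof. exact: le_trans (norm_fst _) (norm_snd _). Qed.
Lemma norm_yD y : `|yD y| <= `|y|.
Proof. exact: le_trans (norm_snd _) (norm_snd _). Qed.

Lemma compact_prod_ball (U V : normedModType R) (M : R) :
  compact [set y : U | `|y| <= M] -> compact [set y : V | `|y| <= M] ->
  compact [set y : U * V | `|y| <= M].
Proof.
move=> cU cV.
rewrite (_ : [set y | _] = [set y : U | `|y| <= M] `*` [set y : V | `|y| <= M]).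
  exact: compact_setX.
by apply/seteqP; split => y /=; rewrite prod_normE ge_max => /andP.
Qed.

Lemma compact_state_ball (M : R) : compact [set y : state R | `|y| <= M].
Proof.
have c : compact [set y : R | `|y| <= M].
  rewrite (_ : [set y | _] = `[- M, M]%classic); first exact: segment_compact.
  by apply/seteqP; split => y /=; rewrite in_itv/= ler_norml.
have cp := compact_prod_ball c c.
exact: (compact_prod_ball (compact_prod_ball cp cp) cp).
Qed.

Lemma norm_pair_le (U V : normedModType R) (u : U) (v : V) (M : R) :
  `|u| <= M -> `|v| <= M -> `|(u, v)| <= M.
Proof. by move=> uM vM; rewrite prod_normE ge_max uM. Qed.

Lemma norm_cos_le1 (a : R) : `|cos a| <= 1.
Proof. by rewrite ler_norml cos_geN1 cos_le1. Qed.

Lemma norm_sin_le1 (a : R) : `|sin a| <= 1.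
Proof. by rewrite ler_norml sin_geN1 sin_le1. Qed.

Lemma continuous_pair (T U V : topologicalType) (g : T -> U) (h : T -> V) (y : T) :
  {for y, continuous g} -> {for y, continuous h} ->
  {for y, continuous (fun t => (g t, h t))}.
Proof. by move=> gc hc; exact: (cvg_pair gc hc). Qed.

Definition velocity (phi chi psi : state R -> R) y : state R :=
  ((alpha * cos (phi y), alpha * sin (phi y)),
   (cos (chi y), sin (chi y)), (cos (psi y), sin (psi y))).

Definition contact y := captured y || intercepted y.

(** This makes the infimum of the contact times a contact time. Two players at distance eta or more,
    each moving by less than eta / 2, cannot have met. *)
Lemma contact_closed (z : R -> state R) (s : R) :
  (forall r t : R, 0 <= r -> r <= t -> `|z t - z r| <= t - r) -> 0 <= s ->
  (forall e, 0 < e -> exists t, [/\ s <= t, t < s + e & contact (z t)]) ->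
  contact (z s).
Proof.
move=> zl s0 near_s; rewrite /contact; apply/norP => -[].
rewrite /captured -subr_eq0 => AT; rewrite /intercepted -subr_eq0 => AD.
pose eta := Num.min `|posA (z s) - posT (z s)| `|posA (z s) - posD (z s)|.
have eta0 : 0 < eta by rewrite lt_min !normr_gt0 AT.
have [t [st tse ct]] := near_s _ (divr_gt0 eta0 (ltr0Sn R 1)).
have zts := zl s t s0 st.
have A1 : `|posA (z t) - posA (z s)| <= `|z t - z s|.
  exact: (le_trans (norm_snd (z t - z s).1) (norm_fst _)).
have T1 : `|posT (z t) - posT (z s)| <= `|z t - z s|.
  exact: (le_trans (norm_fst (z t - z s).1) (norm_fst _)).
have D1 : `|posD (z t) - posD (z s)| <= `|z t - z s|.
  exact: (norm_snd (z t - z s)).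
have key (a b a' b' : R * R) : a = b -> `|a' - b'| <= `|a - a'| + `|b - b'|.
  move=> ->; have -> : a' - b' = (b - b') - (b - a') by rewrite opprB [RHS]addrC addrA subrK.
  by apply: (le_trans (ler_normB _ _)); rewrite addrC.
have etaT : eta <= `|posA (z s) - posT (z s)| by rewrite ge_min lexx.
have etaD : eta <= `|posA (z s) - posD (z s)| by rewrite ge_min lexx orbT.
case/orP: ct => /eqP/key.
  by move=> /(_ (posA (z s)) (posT (z s))); move: tse; lra.
by move=> /(_ (posA (z s)) (posD (z s))); move: tse; lra.
Qed.

(** The velocity field is bounded everywhere and continuous off contact, so the curve given by
    [peano] solves the closed loop until its first contact, where the play is stopped. *)
Lemma play_exists x phi chi psi : `|alpha| <= 1 ->
  continuous_feedback phi -> continuous_feedback chi -> continuous_feedback psi ->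
  exists z tf, play alpha x phi chi psi z tf.
Proof.
move=> alpha1 [_ cphi] [_ cchi] [_ cpsi].
pose f := velocity phi chi psi.
have f1 y : `|f y| <= 1.
  have alpha_le a : `|a| <= 1 -> `|alpha * a| <= 1.
    by move=> a1; rewrite normrM mulr_ile1.
  by rewrite /f /velocity !norm_pair_le// ?alpha_le// ?norm_cos_le1 ?norm_sin_le1.
have fc y : ~~ contact y -> {for y, continuous f}.
  rewrite negb_or => /andP[nc ni].
  have [p1 p2] := cphi y nc ni; have [a1 a2] := cchi y nc ni.
  have [d1 d2] := cpsi y nc ni.
  apply: continuous_pair; [apply: continuous_pair|]; apply: continuous_pair => //.
  - by apply: cvgM => //; exact: cvg_cst.
  - by apply: cvgM => //; exact: cvg_cst.
have [z [z0 zl zd]] := peano x f1 compact_state_ball.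
have sol t : 0 < t -> ~~ contact (z t) -> closed_loop alpha phi chi psi z t.
  move=> t0 /fc fct; have zdt := zd t t0 fct.
  (* A coordinate is a linear functional of norm at most 1, so it inherits the estimate on z. *)
  have der (p : state R -> R) q : p (f (z t)) = q -> (forall y, `|p y| <= `|y|) ->
      (forall (u v w : state R) (c : R), p (u - v - c *: w) = p u - p v - p w * c) ->
      is_derive t 1 (fun s => p (z s)) q.
    move=> <- p1 plin; apply/is_derive_epsP => e e0.
    have [d d0 Hd] := zdt e e0; exists d => // h /Hd; rewrite -plin.
    exact: le_trans.
  refine (conj _ (conj _ (conj _ (conj _ (conj _ _))))).
  - apply: (@der (@xT R) _ erefl) => [y|u v w c]; first exact: norm_xT.
    by rewrite /xT/posT/= /GRing.scale/= mulrC.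
  - apply: (@der (@yT R) _ erefl) => [y|u v w c]; first exact: norm_yT.
    by rewrite /yT/posT/= /GRing.scale/= mulrC.
  - apply: (@der (@xA R) _ erefl) => [y|u v w c]; first exact: norm_xA.
    by rewrite /xA/posA/= /GRing.scale/= mulrC.
  - apply: (@der (@yA R) _ erefl) => [y|u v w c]; first exact: norm_yA.
    by rewrite /yA/posA/= /GRing.scale/= mulrC.
  - apply: (@der (@xD R) _ erefl) => [y|u v w c]; first exact: norm_xD.
    by rewrite /xD/posD/= /GRing.scale/= mulrC.
  - apply: (@der (@yD R) _ erefl) => [y|u v w c]; first exact: norm_yD.
    by rewrite /yD/posD/= /GRing.scale/= mulrC.
have [[t1 [t10 ct1]]|noc] := pselect (exists t, 0 <= t /\ contact (z t)); last first.
  exists z, +oo%E; split => //.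
  - by move=> s t s0 st _; exact: zl.
  - apply/aeW => /= t t0 _; apply: sol => //.
    by apply/negP => ct; apply: noc; exists t; rewrite (ltW t0).
  - move=> t t0 _; apply/andP; rewrite -negb_or; apply/negP => ct.
    by apply: noc; exists t.
pose S := [set t | 0 <= t /\ contact (z t)].
have infS : has_inf S by split; [exists t1|exists 0 => t []].
have tf0 : 0 <= inf S by apply: lb_le_inf => [|t []]//; exists t1.
have ctf : contact (z (inf S)).
  apply: contact_closed => // e e0.
  have [t [t0 ct] tS] := inf_adherent e0 infS.
  by exists t; split => //; apply: ge_inf => //; exact: infS.2.
have before t : 0 <= t -> t < inf S -> ~~ contact (z t).
  move=> t0 ttf; apply/negP => ct.
  have : inf S <= t by apply: ge_inf => //; exact: infS.2.
  by rewrite leNgt ttf.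
exists z, (inf S)%:E; split => //.
- by move=> s t s0 st _; exact: zl.
- apply/aeW => /= t t0; rewrite lte_fin => ttf; apply: sol => //.
  by apply: before => //; exact: ltW.
- move=> t t0; rewrite lte_fin => ttf; apply/andP; rewrite -negb_or.
  exact: before.
- by move=> t [<-].
Qed.

End PlayExistence.

(** * Derivative estimates at a state *)

Section PlaneGeometry.
Variable R : realType.

Lemma le_of_sqr (x y : R) : 0 <= y -> x ^+ 2 <= y ^+ 2 -> x <= y.
Proof.
move=> y0 xy; apply: (le_trans (ler_norm x)).
by rewrite -(ger0_norm y0) -ler_sqr ?nnegrE// -!normrX !ger0_norm ?sqr_ge0.
Qed.

(** Cauchy-Schwarz for w and p e + q n, whose norm is s; the gap between the two squares is the
    square of a cross product. Opponents' velocities are known through this inequality only. *)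
Lemma dot_bound (e1 e2 n1 n2 w1 w2 M p q s : R) :
  e1 ^+ 2 + e2 ^+ 2 = 1 -> n1 ^+ 2 + n2 ^+ 2 = 1 ->
  w1 ^+ 2 + w2 ^+ 2 = M ^+ 2 -> 0 <= M -> 0 <= s ->
  s ^+ 2 = p ^+ 2 + q ^+ 2 + 2 * p * q * (e1 * n1 + e2 * n2) ->
  p * (e1 * w1 + e2 * w2) + q * (n1 * w1 + n2 * w2) <= M * s.
Proof.
move=> ee nn ww M0 s0 s2; apply: le_of_sqr; first exact: mulr_ge0.
rewrite exprMn s2 -ww.
have -> : p ^+ 2 + q ^+ 2 + 2 * p * q * (e1 * n1 + e2 * n2) =
    (p * e1 + q * n1) ^+ 2 + (p * e2 + q * n2) ^+ 2.
  transitivity (p ^+ 2 * (e1 ^+ 2 + e2 ^+ 2) + q ^+ 2 * (n1 ^+ 2 + n2 ^+ 2)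
    + 2 * p * q * (e1 * n1 + e2 * n2)); last by ring.
  by rewrite ee nn !mulr1.
rewrite -subr_ge0.
rewrite (_ : _ - _ = (w1 * (p * e2 + q * n2) - w2 * (p * e1 + q * n1)) ^+ 2).
  exact: sqr_ge0.
by ring.
Qed.

Variables (alpha k m rho L c1 c2 d1 d2 ea na : R).
Hypothesis alpha0 : 0 < alpha.
Hypothesis alpha1 : alpha < 1.
Hypothesis k_itv : -1 <= k <= 1.
Hypothesis m0 : 0 < m.
Hypothesis m2 : m ^+ 2 = 1 + alpha ^+ 2 - 2 * alpha * k.
Hypothesis rho0 : 0 < rho.
Hypothesis L0 : 0 < L.

(** Eliminating k turns identities modulo the quadratic relation for m into plain rational
    identities. *)
Let kE : k = (1 + alpha ^+ 2 - m ^+ 2) / (2 * alpha).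
Proof. by rewrite m2; field; rewrite gt_eqF. Qed.

Lemma m_ge : 1 - alpha <= m.
Proof.
apply: le_of_sqr; first exact: ltW.
rewrite m2; have /andP[_ k1] := k_itv.
have : alpha * k <= alpha * 1 by rewrite ler_wpM2l// ltW.
by move=> h; have -> : (1 - alpha) ^+ 2 = 1 + alpha ^+ 2 - 2 * (alpha * 1); [ring|lra].
Qed.

Lemma m_le2 : m <= 2.
Proof.
apply: le_of_sqr => //; rewrite m2; have /andP[k1 _] := k_itv.
have h : alpha * (-1) <= alpha * k by rewrite ler_wpM2l// ltW.
have h2 : alpha ^+ 2 <= 1 by rewrite expr_le1// ltW.
have -> : 2 ^+ 2 = 4 :> R by ring.
by move: h h2 alpha1; lra.
Qed.

(** The quotient is the component along n of the unit vector (e - alpha n) / m. *)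
Lemma abs_proj_le1 : `|(k - alpha) / m| <= 1.
Proof.
rewrite normrM normfV (gtr0_norm m0) ler_pdivrMr// mul1r.
apply: le_of_sqr; first exact: ltW.
rewrite real_normK ?num_real// m2.
have /andP[k1 k2] := k_itv.
have : 0 <= (1 - k) * (1 + k) by apply: mulr_ge0; move: k1 k2; lra.
by rewrite -subr_ge0 => h; rewrite -subr_ge0; move: h; rewrite !expr2; lra.
Qed.

(* In this section [ea], [na] are the components e.a, n.a of A's unit velocity,
   [c1], [c2] those of T's velocity and [d1], [d2] those of D's; [m] is the norm
   of e - alpha n. *)
Definition margin_of : R :=
  rho * L * k - alpha * rho * L + (1 - alpha ^+ 2) / 2 * L ^+ 2.

(** These are the time derivatives of rho, of L, of (A - D).(T - A) = rho L k, of [lead_of] and of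
    [margin_of], in terms of the velocity components. *)
Definition Drho : R := c1 - ea.
Definition DL : R := na - d2.
Definition Ddot : R := rho * (ea - d1) + L * (c2 - na).
Definition Dlead : R := Ddot - alpha * (Drho * L + rho * DL).
Definition Dmargin : R := Dlead + (1 - alpha ^+ 2) * L * DL.

(** * Estimates when A moves along e - alpha n, against arbitrary T and D *)

Section Attacker.
Hypothesis eaE : ea = (1 - alpha * k) / m.
Hypothesis naE : na = (k - alpha) / m.
Hypothesis vb : forall p q s : R, 0 <= s ->
  s ^+ 2 = p ^+ 2 + q ^+ 2 + 2 * p * q * k -> p * c1 + q * c2 <= alpha * s.
Hypothesis db : forall p q s : R, 0 <= s ->
  s ^+ 2 = p ^+ 2 + q ^+ 2 + 2 * p * q * k -> p * d1 + q * d2 <= s.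

(** The opponents separate: T enters through its product with alpha e - n, D through its product
    with rho e + ((1 - alpha^2) L - alpha rho) n. *)
Lemma Dmargin_attackerE : Dmargin = rho * m + (alpha * m + c2 - alpha * c1) * L
  - (rho * d1 + ((1 - alpha ^+ 2) * L - alpha * rho) * d2).
Proof.
rewrite /Dmargin /Dlead /Ddot /Drho /DL eaE naE kE; field.
by rewrite !gt_eqF.
Qed.

Let target_slack : 0 <= alpha * m + c2 - alpha * c1.
Proof.
have := @vb alpha (-1) m (ltW m0).
by rewrite m2 => /(_ ltac:(ring)); lra.
Qed.

(** The norm of the vector against which D is tested equals rho m exactly when the margin is 0, so
    that there D cannot lower the margin. *)
Let defender_norm : rho ^+ 2 + ((1 - alpha ^+ 2) * L - alpha * rho) ^+ 2
   + 2 * rho * ((1 - alpha ^+ 2) * L - alpha * rho) * k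
  = (rho * m) ^+ 2 + 2 * (1 - alpha ^+ 2) * margin_of.
Proof. by rewrite /margin_of kE; field; rewrite gt_eqF. Qed.

(** The Gronwall constant of the Attacker's estimates: m >= 1 - alpha cancels a factor of 1 -
    alpha^2. *)
Let speed_ratio_le (r : R) : 0 < r -> r <= rho ->
  (1 - alpha ^+ 2) / (rho * m) <= (1 + alpha) / r.
Proof.
move=> r0 rrho; rewrite ler_pdivrMr ?mulr_gt0// mulrAC ler_pdivlMr//.
have -> : 1 - alpha ^+ 2 = (1 + alpha) * (1 - alpha) by ring.
rewrite -mulrA ler_wpM2l//; first by rewrite addr_ge0// ltW.
rewrite mulrC; apply: ler_pM => //; [exact: ltW| |exact: m_ge].
by rewrite subr_ge0 ltW.
Qed.

(** D takes away at most the norm q of its vector, A contributes rho m and T a nonnegative amount; q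
    exceeds rho m only by a multiple of a positive margin. *)
Lemma Dmargin_attacker_ge (r : R) : 0 < r -> r <= rho ->
  - ((1 + alpha) / r) * `|margin_of| <= Dmargin.
Proof.
move=> r0 rrho.
have rm0 : 0 < rho * m by rewrite mulr_gt0.
have a2 : 0 < 1 - alpha ^+ 2 by rewrite subr_gt0 expr_lt1// ltW.
pose q := Num.sqrt ((rho * m) ^+ 2 + 2 * (1 - alpha ^+ 2) * margin_of).
have qq : q ^+ 2 = (rho * m) ^+ 2 + 2 * (1 - alpha ^+ 2) * margin_of.
  rewrite sqr_sqrtr// -defender_norm.
  set y := _ - alpha * rho; have /andP[k1 k2] := k_itv.
  have -> : rho ^+ 2 + y ^+ 2 + 2 * rho * y * k =
    (rho + y * k) ^+ 2 + y ^+ 2 * ((1 - k) * (1 + k)) by ring.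
  apply: addr_ge0; first exact: sqr_ge0.
  by apply: mulr_ge0; [exact: sqr_ge0|apply: mulr_ge0; move: k1 k2; lra].
have q0 : 0 <= q by exact: sqrtr_ge0.
have dq := @db rho ((1 - alpha ^+ 2) * L - alpha * rho) q q0 _.
have {}dq := dq (etrans qq (esym defender_norm)).
have low : rho * m - q <= Dmargin.
  rewrite Dmargin_attackerE.
  have : 0 <= (alpha * m + c2 - alpha * c1) * L by exact: (mulr_ge0 target_slack (ltW L0)).
  by move: dq; lra.
apply: le_trans low.
have [s0|s0] := leP margin_of 0.
  have : q <= rho * m.
    apply: le_of_sqr; first exact: ltW.
    by rewrite qq gerDl pmulr_rle0// mulr_gt0.
  have : - ((1 + alpha) / r) * `|margin_of| <= 0.
    rewrite mulNr oppr_le0; apply: mulr_ge0 => //.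
    by apply: divr_ge0; move: alpha0 r0; lra.
  by lra.
rewrite gtr0_norm//.
(* This is sqrt(a^2 + 2 b) <= a + b / a, with a = rho m and b = (1 - alpha^2) [margin_of]. *)
set x := (1 - alpha ^+ 2) * margin_of / (rho * m).
have x0 : 0 <= x by rewrite /x divr_ge0 ?mulr_ge0 ?ltW.
have qx : q <= rho * m + x.
  apply: le_of_sqr; first by rewrite addr_ge0// ltW.
  have -> : (rho * m + x) ^+ 2 =
     (rho * m) ^+ 2 + 2 * (1 - alpha ^+ 2) * margin_of + x ^+ 2.
    by rewrite /x; field; rewrite !gt_eqF.
  by rewrite qq lerDl sqr_ge0.
suff : x <= (1 + alpha) / r * margin_of by lra.
by rewrite /x mulrAC ler_wpM2r ?(ltW s0)// speed_ratio_le.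
Qed.

(* G = G' = 0 is the equality case of Cauchy-Schwarz for the direction of D; it
   is used in the form of [db] perturbed by [h] in the second coefficient. *)
Lemma DL_attacker_ge (r : R) : 0 < r -> r <= rho ->
  margin_of = 0 -> Dmargin = 0 -> - ((1 + alpha) / r) * L <= DL.
Proof.
move=> r0 rrho s0 Ds0.
have rm0 : 0 < rho * m by rewrite mulr_gt0.
have a2 : 0 < 1 - alpha ^+ 2 by rewrite subr_gt0 expr_lt1// ltW.
set y := (1 - alpha ^+ 2) * L - alpha * rho.
have yn : rho ^+ 2 + y ^+ 2 + 2 * rho * y * k = (rho * m) ^+ 2.
  by rewrite defender_norm s0 mulr0 addr0.
have dlow : rho * m <= rho * d1 + y * d2.
  have := Dmargin_attackerE; rewrite Ds0 -/y.
  have : 0 <= (alpha * m + c2 - alpha * c1) * L by exact: (mulr_ge0 target_slack (ltW L0)).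
  by lra.
suff d2le : d2 <= (y + rho * k) / (rho * m).
  rewrite /DL naE.
  have h : (y + rho * k) / (rho * m) =
      (k - alpha) / m + (1 - alpha ^+ 2) * L / (rho * m).
    by rewrite /y; field; rewrite !gt_eqF.
  suff : (1 - alpha ^+ 2) * L / (rho * m) <= (1 + alpha) / r * L.
    by move: d2le; rewrite h; lra.
  by rewrite mulrAC ler_wpM2r ?(ltW L0)// speed_ratio_le.
apply/ler_addgt0Pr => eps eps0.
(* The step h makes the second-order term h^2 / (2 rho m) equal to h eps. Dividing by h then bounds
   d2 by the derivative in y of the norm of rho e + y n, up to eps. *)
pose h := 2 * (rho * m) * eps.
have h0 : 0 < h by rewrite !mulr_gt0.
pose x := (2 * h * (y + rho * k) + h ^+ 2) / (2 * (rho * m)).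
pose s := Num.sqrt (rho ^+ 2 + (y + h) ^+ 2 + 2 * rho * (y + h) * k).
have sE : s ^+ 2 = rho ^+ 2 + (y + h) ^+ 2 + 2 * rho * (y + h) * k.
  rewrite sqr_sqrtr//; set w := y + h; have /andP[k1 k2] := k_itv.
  have -> : rho ^+ 2 + w ^+ 2 + 2 * rho * w * k =
    (rho + w * k) ^+ 2 + w ^+ 2 * ((1 - k) * (1 + k)) by ring.
  apply: addr_ge0; first exact: sqr_ge0.
  by apply: mulr_ge0; [exact: sqr_ge0|apply: mulr_ge0; move: k1 k2; lra].
have s0' : 0 <= s by exact: sqrtr_ge0.
have ds := db s0' sE.
have sx : s <= rho * m + x.
  have [neg|pos] := leP (rho * m + x) 0; last first.
    apply: le_of_sqr; first exact: ltW.
    rewrite sE.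
    have -> : rho ^+ 2 + (y + h) ^+ 2 + 2 * rho * (y + h) * k =
      (rho ^+ 2 + y ^+ 2 + 2 * rho * y * k) + (2 * h * (y + rho * k) + h ^+ 2) by ring.
    have -> : (rho * m + x) ^+ 2 = (rho * m) ^+ 2 +
       (2 * h * (y + rho * k) + h ^+ 2) + x ^+ 2.
      by rewrite /x; field; rewrite !gt_eqF.
    by rewrite yn lerDl sqr_ge0.
  exfalso.
  have : s ^+ 2 = (rho * m) ^+ 2 + 2 * (rho * m) * x.
    by rewrite sE -yn /x; field; rewrite !gt_eqF.
  have := sqr_ge0 s; move=> h1 h2; rewrite h2 in h1.
  have : 0 <= (rho * m) * (rho * m + 2 * x).
    by move: h1; rewrite expr2; lra.
  rewrite pmulr_rge0// => h3.
  by move: neg h3 rm0; lra.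
have : h * d2 <= h * ((y + rho * k) / (rho * m) + eps).
  have -> : h * ((y + rho * k) / (rho * m) + eps) = x.
    by rewrite /x /h; field; rewrite !gt_eqF.
  by move: ds dlow sx; lra.
by rewrite ler_pM2l.
Qed.

(** As rho L (k - alpha), it has the sign of the component of A's aimed direction along n. *)
Definition lead_of : R := rho * L * k - alpha * rho * L.

(** Without the quadratic term of the margin, D is tested against rho (e - alpha n) only; its norm
    rho m is exactly what A contributes. *)
Lemma Dlead_attacker_ge :
  L * (alpha * m + c2 - alpha * c1 - (1 - alpha ^+ 2) * na) <= Dlead.
Proof.
have := Dmargin_attackerE; rewrite /Dmargin => h.
have := @db 1 (- alpha) m (ltW m0).
rewrite m2 => /(_ ltac:(ring)) h1.
have h2 : rho * (1 * d1 + - alpha * d2) <= rho * m by rewrite ler_pM2l.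
have h3 : rho * d1 + ((1 - alpha ^+ 2) * L - alpha * rho) * d2 =
  rho * (1 * d1 + - alpha * d2) + (1 - alpha ^+ 2) * L * d2 by ring.
have h4 : (1 - alpha ^+ 2) * L * DL =
  (1 - alpha ^+ 2) * L * na - (1 - alpha ^+ 2) * L * d2 by rewrite /DL; ring.
have h5 : L * (alpha * m + c2 - alpha * c1 - (1 - alpha ^+ 2) * na) =
  (alpha * m + c2 - alpha * c1) * L - (1 - alpha ^+ 2) * L * na by ring.
by move: h h2; rewrite h3 h4 h5; lra.
Qed.

(** The right-hand side is rho^3 times the derivative of lead / rho^2. T is tested against (2 k -
    alpha) e - n, the mirror image of n - alpha e in the line of e, hence of norm m. *)
Lemma Dlead_ratio_ge : m * lead_of <= Dlead * rho - 2 * lead_of * Drho.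
Proof.
have h1 := Dlead_attacker_ge.
have h2 : 0 <= alpha * m + (c2 + (alpha - 2 * k) * c1).
  have := @vb (2 * k - alpha) (-1) m (ltW m0).
  by rewrite m2 => /(_ ltac:(ring)); lra.
have h3 : L * (alpha * m + c2 - alpha * c1 - (1 - alpha ^+ 2) * na) * rho
     <= Dlead * rho by rewrite ler_pM2r.
have h4 : 0 <= rho * L * (alpha * m + (c2 + (alpha - 2 * k) * c1)).
  by rewrite !mulr_ge0// ltW.
have -> : m * lead_of =
   L * (alpha * m + c2 - alpha * c1 - (1 - alpha ^+ 2) * na) * rho - 2 * lead_of * Drho
   - rho * L * (alpha * m + (c2 + (alpha - 2 * k) * c1)).
  by rewrite /lead_of /Drho eaE naE kE; field; rewrite !gt_eqF.
by lra.
Qed.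

Lemma target_gain_ge0 : k <= alpha ->
  0 <= alpha * m + c2 - alpha * c1 - (1 - alpha ^+ 2) * na.
Proof.
move=> ka; have a2 : 0 < 1 - alpha ^+ 2 by rewrite subr_gt0 expr_lt1// ltW.
have : (1 - alpha ^+ 2) * na <= 0.
  by rewrite naE pmulr_rle0// pmulr_lle0 ?invr_gt0// subr_le0.
by move: target_slack; lra.
Qed.

(* The bracket is the guaranteed growth rate of [lead] per unit of [L]: fleeing
   away from A only delays capture at the expense of this growth. *)
Lemma Drho_attacker_le : k <= alpha ->
  Drho <= - ((1 - alpha ^+ 2) / 4)
    + (1 - alpha ^+ 2)^-1 * (alpha * m + c2 - alpha * c1 - (1 - alpha ^+ 2) * na).
Proof.
move=> ka; have a2 : 0 < 1 - alpha ^+ 2 by rewrite subr_gt0 expr_lt1// ltW.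
set K := (1 - alpha ^+ 2)^-1; have K0 : 0 < K by rewrite invr_gt0.
have KE : K * (1 - alpha ^+ 2) = 1 by rewrite mulVf// gt_eqF.
(* Collecting the terms in c1 and c2 tests T against (1 + K alpha) e - K n, whose norm is s; X
   bounds s - K m by sqrt(a^2 + b) <= a + b / (2 a). *)
pose s := Num.sqrt ((K * m) ^+ 2 + 2 * K * (alpha - k) + 1).
have sE : s ^+ 2 = (1 + K * alpha) ^+ 2 + (- K) ^+ 2 + 2 * (1 + K * alpha) * (- K) * k.
  rewrite sqr_sqrtr; first by rewrite exprMn m2; ring.
  by rewrite !addr_ge0 ?sqr_ge0// !mulr_ge0 ?(ltW K0)// subr_ge0.
have s0 : 0 <= s by exact: sqrtr_ge0.
have vs := vb s0 sE.
pose X := (2 * K * (alpha - k) + 1) / (2 * K * m).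
have X0 : 0 <= X.
  rewrite divr_ge0// ?addr_ge0// ?mulr_ge0 ?(ltW K0) ?(ltW m0)//.
  by rewrite subr_ge0.
have sX : s <= K * m + X.
  apply: le_of_sqr; first by rewrite addr_ge0// mulr_ge0 ?ltW.
  rewrite sqr_sqrtr; last first.
    by rewrite !addr_ge0 ?sqr_ge0// !mulr_ge0 ?(ltW K0)// subr_ge0.
  have -> : (K * m + X) ^+ 2 =
    (K * m) ^+ 2 + 2 * K * (alpha - k) + 1 + X ^+ 2.
    by rewrite /X; field; rewrite !gt_eqF.
  by rewrite lerDl sqr_ge0.
have h1 : alpha * s <= alpha * (K * m) + alpha * X.
  by rewrite -mulrDr ler_pM2l.
suff h2 : alpha * X + (1 - alpha ^+ 2) / 4 <= ea - na.
  have -> : K * (alpha * m + c2 - alpha * c1 - (1 - alpha ^+ 2) * na) =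
    alpha * (K * m) + K * c2 - K * alpha * c1 - na.
    by rewrite mulrBr mulrA KE mul1r; ring.
  by rewrite /Drho; move: vs h1 h2; lra.
rewrite eaE naE -mulrBl ler_pdivlMr//.
have XE : X * m = (alpha - k) + (1 - alpha ^+ 2) / 2.
  have -> : X * m = (alpha - k) + K^-1 / 2 by rewrite /X; field; rewrite !gt_eqF.
  by rewrite invrK.
rewrite mulrDl -mulrA XE.
have h3 : alpha * (alpha - k + (1 - alpha ^+ 2) / 2) <= 1 * (alpha - k + (1 - alpha ^+ 2) / 2).
  rewrite ler_wpM2r ?(ltW alpha1)// addr_ge0 ?divr_ge0 ?subr_ge0//.
  by rewrite -subr_ge0 ltW.
have h4 : (1 - alpha ^+ 2) / 4 * m <= (1 - alpha ^+ 2) / 4 * 2.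
  by rewrite ler_wpM2l ?m_le2// divr_ge0// ltW.
have h5 : alpha * k <= alpha * alpha by rewrite ler_pM2l.
by move: h3 h4 h5; rewrite expr2; lra.
Qed.

End Attacker.

(** * Estimate when T and D follow the team directions, against an arbitrary A *)

Section Team.
Hypothesis c1E : c1 = alpha * ((alpha - k) / m).
Hypothesis c2E : c2 = alpha * ((alpha * k - 1) / m).
Hypothesis d1E : d1 = (1 + (alpha - 2 * k) * k) / m.
Hypothesis d2E : d2 = (alpha - k) / m.
Hypothesis ab : forall p q s : R, 0 <= s ->
  s ^+ 2 = p ^+ 2 + q ^+ 2 + 2 * p * q * k -> p * ea + q * na <= s.

(** A enters only through its product with e - alpha n, of norm m, and so contributes a nonpositive
    term; the rest is margin / L times a coefficient of absolute value at most 2. *)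
Lemma Dmargin_team_le (l : R) : 0 < l -> l <= L ->
  Dmargin <= 2 / l * `|margin_of|.
Proof.
move=> l0 lL.
have := @ab 1 (- alpha) m (ltW m0).
rewrite m2 => /(_ ltac:(ring)) h1.
have h2 : (rho + alpha * L) * (1 * ea + - alpha * na) <= (rho + alpha * L) * m.
  by rewrite ler_wpM2l// addr_ge0 ?mulr_ge0// ltW.
have h3 : Dmargin = (rho + alpha * L) * (1 * ea + - alpha * na) - (rho + alpha * L) * m
     + 2 * ((k - alpha) / m) * (margin_of / L).
  rewrite /Dmargin /Dlead /Ddot /Drho /DL /margin_of c1E c2E d1E d2E kE; field.
  by rewrite !gt_eqF.
have h4 : 2 * ((k - alpha) / m) * (margin_of / L) <= 2 / l * `|margin_of|.
  apply: (le_trans (ler_norm _)); rewrite normrM (normrM 2) [`|margin_of / L|]normrM.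
  rewrite normfV (gtr0_norm L0) (ger0_norm (ler0n _ 2)).
  rewrite -mulrA -[leRHS]mulrA ler_pM2l//.
  apply: (@le_trans _ _ (1 * (`|margin_of| / L))).
    by rewrite ler_wpM2r ?abs_proj_le1// divr_ge0// ltW.
  rewrite mul1r mulrC ler_wpM2r// lef_pV2//.
by move: h2 h3 h4; lra.
Qed.

End Team.
End PlaneGeometry.

(** * The optimal strategies *)

Section Headings.
Variable R : realType.

(** The jump of the angle at the direction (-1, 0) is harmless, since only its cosine and sine have
    to be continuous. *)
Definition angle (c s : R) : R := if 0 <= s then acos c else - acos c.

Lemma angle_itv (c s : R) : c ^+ 2 + s ^+ 2 = 1 -> - pi <= angle c s <= pi.
Proof.
move=> cs; have /andP[c1 c2] : -1 <= c <= 1.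
  rewrite -ler_norml -(@ler_pXn2r R 2) ?nnegrE// expr1n real_normK ?num_real//.
  by rewrite -cs lerDl sqr_ge0.
have a0 : 0 <= acos c by apply: acos_ge0; rewrite c1.
have api : acos c <= pi by apply: acos_lepi; rewrite c1.
by rewrite /angle; case: ifP => _; apply/andP; split; have := pi_ge0 R; lra.
Qed.

Lemma cos_sin_angle (c s : R) : c ^+ 2 + s ^+ 2 = 1 ->
  cos (angle c s) = c /\ sin (angle c s) = s.
Proof.
move=> cs; have c1 : -1 <= c <= 1.
  rewrite -ler_norml -(@ler_pXn2r R 2) ?nnegrE// expr1n real_normK ?num_real//.
  by rewrite -cs lerDl sqr_ge0.
have sE : Num.sqrt (1 - c ^+ 2) = `|s| by rewrite -cs addrC addKr sqrtr_sqr.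
rewrite /angle; case: ifP => [s0|/negbT s0].
  by rewrite acosK// sin_acos// sE ger0_norm.
rewrite cosN sinN acosK// sin_acos// sE ltr0_norm ?opprK//.
by rewrite ltNge.
Qed.

End Headings.

Section Strategies.
Variables (R : realType) (alpha : R).
Hypothesis alpha0 : 0 < alpha.
Hypothesis alpha1 : alpha < 1.
Implicit Types (y : state R) (z : R -> state R) (t : R).

Definition rho y : R := dist (posT y) (posA y).
Definition sep y : R := dist (posA y) (posD y).
(** The product rho L k as a polynomial in the coordinates: it stays meaningful, and Lipschitz along
    plays, at contact, where e or n degenerates. *)
Definition dotp y : R :=
  (xA y - xD y) * (xT y - xA y) + (yA y - yD y) * (yT y - yA y).
Definition lead y : R := dotp y - alpha * rho y * sep y.
Definition margin y : R := lead y + (1 - alpha ^+ 2) / 2 * sep y ^+ 2.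

Definition e1 y : R := (xT y - xA y) / rho y.
Definition e2 y : R := (yT y - yA y) / rho y.
Definition cos_en y : R := e1 y * cos_sigma y + e2 y * sin_sigma y.
Definition aim_norm y : R := Num.sqrt (1 + alpha ^+ 2 - 2 * alpha * cos_en y).

Definition aim_A1 y : R := (e1 y - alpha * cos_sigma y) / aim_norm y.
Definition aim_A2 y : R := (e2 y - alpha * sin_sigma y) / aim_norm y.
Definition aim_T1 y : R := (alpha * e1 y - cos_sigma y) / aim_norm y.
Definition aim_T2 y : R := (alpha * e2 y - sin_sigma y) / aim_norm y.
(** First coordinate of the normalized reflection w - 2 (w.n) n of w = e - alpha n. *)
Definition aim_D1 y : R := (e1 y + (alpha - 2 * cos_en y) * cos_sigma y) / aim_norm y.
Definition aim_D2 y : R := (e2 y + (alpha - 2 * cos_en y) * sin_sigma y) / aim_norm y.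

Definition chi_opt y : R :=
  if contact y then 0 else angle (aim_A1 y) (aim_A2 y).
Definition phi_opt y : R :=
  if contact y then 0 else angle (aim_T1 y) (aim_T2 y).
Definition psi_opt y : R :=
  if contact y then 0 else angle (aim_D1 y) (aim_D2 y).

Lemma dist_ge0 (p q : R * R) : 0 <= dist p q.
Proof. exact: sqrtr_ge0. Qed.

Lemma dist_sqr (p q : R * R) :
  dist p q ^+ 2 = (p.1 - q.1) ^+ 2 + (p.2 - q.2) ^+ 2.
Proof. by rewrite sqr_sqrtr// addr_ge0// sqr_ge0. Qed.

Lemma dist_eq0 (p q : R * R) : (dist p q == 0) = (p == q).
Proof.
apply/idP/eqP => [/eqP d0|->]; last first.
  by rewrite /dist !subrr expr0n addr0 sqrtr0.
have := dist_sqr p q; rewrite d0 expr0n/= => /esym/eqP.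
rewrite paddr_eq0 ?sqr_ge0// !sqrf_eq0 !subr_eq0 => /andP[/eqP h1 /eqP h2].
by rewrite (surjective_pairing p) h1 h2 -surjective_pairing.
Qed.

Lemma captured_rho y : captured y = (rho y == 0).
Proof. by rewrite /captured /rho dist_eq0 eq_sym. Qed.

Lemma intercepted_sep y : intercepted y = (sep y == 0).
Proof. by rewrite /intercepted /sep dist_eq0. Qed.

Lemma rho_ge0 y : 0 <= rho y. Proof. exact: dist_ge0. Qed.
Lemma sep_ge0 y : 0 <= sep y. Proof. exact: dist_ge0. Qed.

Lemma no_contactP y : ~~ contact y -> 0 < rho y /\ 0 < sep y.
Proof.
rewrite /contact negb_or captured_rho intercepted_sep => /andP[r0 s0].
by rewrite !lt_neqAle rho_ge0 sep_ge0 !andbT !(eq_sym 0).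
Qed.

Lemma unit_e y : 0 < rho y -> e1 y ^+ 2 + e2 y ^+ 2 = 1.
Proof.
move=> r0; rewrite !expr_div_n -mulrDl -(dist_sqr (posT y) (posA y)).
by rewrite mulfV// expf_neq0// gt_eqF.
Qed.

Lemma unit_n y : 0 < sep y -> cos_sigma y ^+ 2 + sin_sigma y ^+ 2 = 1.
Proof.
move=> s0; rewrite !expr_div_n -mulrDl -(dist_sqr (posA y) (posD y)).
by rewrite mulfV// expf_neq0// gt_eqF.
Qed.

Lemma dotpE y : 0 < rho y -> 0 < sep y -> dotp y = rho y * sep y * cos_en y.
Proof.
move=> r0 s0; rewrite /dotp /cos_en /e1 /e2 /cos_sigma /sin_sigma -/(sep y).
by field; rewrite !gt_eqF.
Qed.

Lemma cos_en_itv y : 0 < rho y -> 0 < sep y -> -1 <= cos_en y <= 1.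
Proof.
move=> r0 s0; have ee := unit_e r0; have nn := unit_n s0.
have h1 := sqr_ge0 (e1 y - cos_sigma y); have h2 := sqr_ge0 (e2 y - sin_sigma y).
have h3 := sqr_ge0 (e1 y + cos_sigma y); have h4 := sqr_ge0 (e2 y + sin_sigma y).
by rewrite /cos_en; apply/andP; split; move: h1 h2 h3 h4 ee nn; rewrite !expr2; lra.
Qed.

Lemma aim_norm_arg_gt0 y : 0 < rho y -> 0 < sep y ->
  0 < 1 + alpha ^+ 2 - 2 * alpha * cos_en y.
Proof.
move=> r0 s0; have /andP[_ k1] := cos_en_itv r0 s0.
have h : alpha * cos_en y <= alpha * 1 by rewrite ler_pM2l.
have : 0 < (1 - alpha) ^+ 2 by rewrite exprn_gt0// subr_gt0.
by rewrite !expr2; move: h; lra.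
Qed.

Lemma aim_norm_gt0 y : 0 < rho y -> 0 < sep y -> 0 < aim_norm y.
Proof. by move=> r0 s0; rewrite sqrtr_gt0 aim_norm_arg_gt0. Qed.

Lemma aim_norm_sqr y : 0 < rho y -> 0 < sep y ->
  aim_norm y ^+ 2 = 1 + alpha ^+ 2 - 2 * alpha * cos_en y.
Proof. by move=> r0 s0; rewrite sqr_sqrtr// ltW// aim_norm_arg_gt0. Qed.

Lemma unit_aim y (p1 p2 : R) : 0 < rho y -> 0 < sep y ->
  p1 ^+ 2 + p2 ^+ 2 = aim_norm y ^+ 2 -> (p1 / aim_norm y) ^+ 2 + (p2 / aim_norm y) ^+ 2 = 1.
Proof.
move=> r0 s0 pp; rewrite !expr_div_n -mulrDl pp mulfV// expf_neq0//.
by rewrite gt_eqF// aim_norm_gt0.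
Qed.

Lemma unit_aim_A y : 0 < rho y -> 0 < sep y -> aim_A1 y ^+ 2 + aim_A2 y ^+ 2 = 1.
Proof.
move=> r0 s0; apply: unit_aim => //; rewrite aim_norm_sqr//.
transitivity ((e1 y ^+ 2 + e2 y ^+ 2) + alpha ^+ 2 * (cos_sigma y ^+ 2 + sin_sigma y ^+ 2)
  - 2 * alpha * cos_en y); first by rewrite /cos_en; ring.
by rewrite unit_e// unit_n// mulr1.
Qed.

Lemma unit_aim_T y : 0 < rho y -> 0 < sep y -> aim_T1 y ^+ 2 + aim_T2 y ^+ 2 = 1.
Proof.
move=> r0 s0; apply: unit_aim => //; rewrite aim_norm_sqr//.
transitivity (alpha ^+ 2 * (e1 y ^+ 2 + e2 y ^+ 2) + (cos_sigma y ^+ 2 + sin_sigma y ^+ 2)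
  - 2 * alpha * cos_en y); first by rewrite /cos_en; ring.
by rewrite unit_e// unit_n// mulr1 (addrC 1).
Qed.

Lemma unit_aim_D y : 0 < rho y -> 0 < sep y -> aim_D1 y ^+ 2 + aim_D2 y ^+ 2 = 1.
Proof.
move=> r0 s0; apply: unit_aim => //; rewrite aim_norm_sqr//.
transitivity ((e1 y ^+ 2 + e2 y ^+ 2)
  + (alpha - 2 * cos_en y) ^+ 2 * (cos_sigma y ^+ 2 + sin_sigma y ^+ 2)
  + 2 * (alpha - 2 * cos_en y) * cos_en y); first by rewrite /cos_en; ring.
by rewrite unit_e// unit_n//; ring.
Qed.

Lemma coord_continuous (p : state R -> R) :
  (forall y y', p (y - y') = p y - p y') -> (forall y, `|p y| <= `|y|) ->
  continuous p.
Proof.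
move=> pB p1 y; apply/cvgrPdist_le => e e0.
near=> y'; rewrite -pB; apply: (le_trans (p1 _)).
by near: y'; apply: cvgr_dist_le => //; exact: cvg_id.
Unshelve. all: by end_near. Qed.

Let xTc : continuous (@xT R).
Proof. by apply: coord_continuous => // y; exact: norm_xT. Qed.
Let yTc : continuous (@yT R).
Proof. by apply: coord_continuous => // y; exact: norm_yT. Qed.
Let xAc : continuous (@xA R).
Proof. by apply: coord_continuous => // y; exact: norm_xA. Qed.
Let yAc : continuous (@yA R).
Proof. by apply: coord_continuous => // y; exact: norm_yA. Qed.
Let xDc : continuous (@xD R).
Proof. by apply: coord_continuous => // y; exact: norm_xD. Qed.
Let yDc : continuous (@yD R).
Proof. by apply: coord_continuous => // y; exact: norm_yD. Qed.

Let hypot_continuous (f g : state R -> R) : continuous f -> continuous g ->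
  continuous (fun y => Num.sqrt (f y ^+ 2 + g y ^+ 2)).
Proof.
move=> fc gc y; apply: (@continuous_comp _ _ _ (fun y => f y ^+ 2 + g y ^+ 2)).
  have sq (h : state R -> R) : continuous h -> {for y, continuous (fun y => h y ^+ 2)}.
    move=> hc; rewrite (_ : (fun y => h y ^+ 2) = fun y => h y * h y).
      by apply: cvgM; exact: hc.
    by apply/funext => ?; rewrite expr2.
  by apply: cvgD; exact: sq.
exact: sqrt_continuous.
Qed.

Lemma rho_continuous : continuous rho.
Proof.
by apply: hypot_continuous => y; apply: cvgB; [exact: xTc|exact: xAc|exact: yTc|exact: yAc].
Qed.

Lemma sep_continuous : continuous sep.
Proof.
by apply: hypot_continuous => y; apply: cvgB; [exact: xAc|exact: xDc|exact: yAc|exact: yDc].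
Qed.

Lemma near_no_contact y : ~~ contact y -> \forall y' \near y, ~~ contact y'.
Proof.
move=> /no_contactP[r0 s0].
near=> y'; rewrite /contact negb_or captured_rho intercepted_sep.
apply/andP; split; near: y'.
- by apply: (cvgr_neq0 (rho y)); [exact: rho_continuous|rewrite gt_eqF].
- by apply: (cvgr_neq0 (sep y)); [exact: sep_continuous|rewrite gt_eqF].
Unshelve. all: by end_near. Qed.

Section AtState.
Variable y : state R.
Hypothesis nc : ~~ contact y.
Let r0 : 0 < rho y. Proof. by have [] := no_contactP nc. Qed.
Let s0 : 0 < sep y. Proof. by have [] := no_contactP nc. Qed.

Let e1c : {for y, continuous e1}.
Proof.
apply: cvgM; first by apply: cvgB; [exact: xTc|exact: xAc].
by apply: cvgV; [rewrite gt_eqF|exact: rho_continuous].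
Qed.
Let e2c : {for y, continuous e2}.
Proof.
apply: cvgM; first by apply: cvgB; [exact: yTc|exact: yAc].
by apply: cvgV; [rewrite gt_eqF|exact: rho_continuous].
Qed.
Let n1c : {for y, continuous (@cos_sigma R)}.
Proof.
apply: cvgM; first by apply: cvgB; [exact: xAc|exact: xDc].
by apply: cvgV; [rewrite gt_eqF|exact: sep_continuous].
Qed.
Let n2c : {for y, continuous (@sin_sigma R)}.
Proof.
apply: cvgM; first by apply: cvgB; [exact: yAc|exact: yDc].
by apply: cvgV; [rewrite gt_eqF|exact: sep_continuous].
Qed.
Let cos_enc : {for y, continuous cos_en}.
Proof. by apply: cvgD; apply: cvgM. Qed.
Let aim_normc : {for y, continuous aim_norm}.
Proof.
apply: (@continuous_comp _ _ _ (fun y => 1 + alpha ^+ 2 - 2 * alpha * cos_en y)).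
  by apply: cvgB; [exact: cvg_cst|apply: cvgM => //; exact: cvg_cst].
exact: sqrt_continuous.
Qed.
Let aim_normVc : {for y, continuous (fun y => (aim_norm y)^-1)}.
Proof. by apply: cvgV => //; rewrite gt_eqF// aim_norm_gt0. Qed.

Let combc (a : R) (f g : state R -> R) :
  {for y, continuous f} -> {for y, continuous g} ->
  {for y, continuous (fun y => f y - a * g y)}.
Proof. by move=> fc gc; apply: cvgB => //; apply: cvgM => //; exact: cvg_cst. Qed.

Lemma aim_A_continuous :
  {for y, continuous aim_A1} /\ {for y, continuous aim_A2}.
Proof. by split; apply: cvgM => //; exact: combc. Qed.

Lemma aim_T_continuous :
  {for y, continuous aim_T1} /\ {for y, continuous aim_T2}.
Proof.
by split; apply: cvgM => //; apply: cvgB => //; apply: cvgM => //; exact: cvg_cst.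
Qed.

Lemma aim_D_continuous :
  {for y, continuous aim_D1} /\ {for y, continuous aim_D2}.
Proof.
by split; apply: cvgM => //; apply: cvgD => //; apply: cvgM => //;
  (apply: cvgB; [exact: cvg_cst|apply: cvgM => //; exact: cvg_cst]).
Qed.

End AtState.

(* Headings at the terminal states are irrelevant; 0 keeps them in [-pi, pi]. *)
Lemma continuous_feedback_angle (h1 h2 : state R -> R) :
  (forall y, ~~ contact y -> h1 y ^+ 2 + h2 y ^+ 2 = 1) ->
  (forall y, ~~ contact y -> {for y, continuous h1} /\ {for y, continuous h2}) ->
  continuous_feedback (fun y => if contact y then 0 else angle (h1 y) (h2 y)).
Proof.
move=> hu hc; split.
  move=> y; case: ifPn => [_|/hu /angle_itv//].
  by have := pi_ge0 R; lra.
move=> y nc ni; have y0 : ~~ contact y by rewrite negb_or nc.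
have [c1 c2] := hc y y0.
(* Near y there is no contact, so the cosine and sine of the heading coincide there with h1 and
   h2. *)
have eq_near (F : R -> R) (h : state R -> R) :
    (forall y', ~~ contact y' -> F (angle (h1 y') (h2 y')) = h y') ->
    {for y, continuous h} ->
    {for y, continuous (fun y' => F (if contact y' then 0 else angle (h1 y') (h2 y')))}.
  move=> Fh hcy; rewrite /prop_for /continuous_at (negbTE y0) Fh//.
  apply: cvg_trans hcy; apply: near_eq_cvg; near=> y'.
  have y'0 : ~~ contact y' by near: y'; exact: near_no_contact.
  by rewrite (negbTE y'0) Fh.
by split; [apply: (eq_near (@cos R) h1)|apply: (eq_near (@sin R) h2)] => // y'
  /hu /cos_sin_angle[].
Unshelve. all: by end_near. Qed.

Lemma chi_opt_continuous : continuous_feedback chi_opt.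
Proof.
apply: continuous_feedback_angle => [y /no_contactP[r0 s0]|y].
  exact: unit_aim_A.
exact: aim_A_continuous.
Qed.

Lemma phi_opt_continuous : continuous_feedback phi_opt.
Proof.
apply: continuous_feedback_angle => [y /no_contactP[r0 s0]|y].
  exact: unit_aim_T.
exact: aim_T_continuous.
Qed.

Lemma psi_opt_continuous : continuous_feedback psi_opt.
Proof.
apply: continuous_feedback_angle => [y /no_contactP[r0 s0]|y].
  exact: unit_aim_D.
exact: aim_D_continuous.
Qed.

Lemma chi_optE y : ~~ contact y ->
  cos (chi_opt y) = aim_A1 y /\ sin (chi_opt y) = aim_A2 y.
Proof.
move=> nc; have [r0 s0] := no_contactP nc.
by rewrite /chi_opt (negbTE nc); apply: cos_sin_angle; exact: unit_aim_A.
Qed.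

Lemma phi_optE y : ~~ contact y ->
  cos (phi_opt y) = aim_T1 y /\ sin (phi_opt y) = aim_T2 y.
Proof.
move=> nc; have [r0 s0] := no_contactP nc.
by rewrite /phi_opt (negbTE nc); apply: cos_sin_angle; exact: unit_aim_T.
Qed.

Lemma psi_optE y : ~~ contact y ->
  cos (psi_opt y) = aim_D1 y /\ sin (psi_opt y) = aim_D2 y.
Proof.
move=> nc; have [r0 s0] := no_contactP nc.
by rewrite /psi_opt (negbTE nc); apply: cos_sin_angle; exact: unit_aim_D.
Qed.

End Strategies.

(** * Transfer of the estimates to the motion at a time without contact *)

Section Motion.
Variables (R : realType) (alpha : R).
Hypothesis alpha0 : 0 < alpha.
Hypothesis alpha1 : alpha < 1.
Implicit Types (y : state R) (z : R -> state R) (t : R).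

Definition along_e y (w : R * R) : R := e1 y * w.1 + e2 y * w.2.
Definition along_n y (w : R * R) : R := cos_sigma y * w.1 + sin_sigma y * w.2.

Lemma motion_derive phi chi psi z t (y := z t)
    (v := (alpha * cos (phi y), alpha * sin (phi y)))
    (a := (cos (chi y), sin (chi y))) (d := (cos (psi y), sin (psi y))) :
  closed_loop alpha phi chi psi z t -> ~~ contact y ->
  [/\ is_derive t 1 (fun s => rho (z s)) (Drho (along_e y v) (along_e y a)),
      is_derive t 1 (fun s => sep (z s)) (DL (along_n y d) (along_n y a)) &
      is_derive t 1 (fun s => dotp (z s))
        (Ddot (rho y) (sep y) (along_n y v) (along_e y d) (along_e y a) (along_n y a))].
Proof.
move=> [dxT [dyT [dxA [dyA [dxD dyD]]]]] nc; have [r0 s0] := no_contactP nc.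
have xTA := derB dxT dxA; have yTA := derB dyT dyA.
have xAD := derB dxA dxD; have yAD := derB dyA dyD.
have rho2 : 0 < (xT y - xA y) ^+ 2 + (yT y - yA y) ^+ 2.
  by rewrite -(dist_sqr (posT y) (posA y)) exprn_gt0.
have sep2 : 0 < (xA y - xD y) ^+ 2 + (yA y - yD y) ^+ 2.
  by rewrite -(dist_sqr (posA y) (posD y)) exprn_gt0.
split.
- apply: (is_derive_eq (@der_hypot R (fun s => xT (z s) - xA (z s))
    (fun s => yT (z s) - yA (z s)) t _ _ rho2 xTA yTA)).
  rewrite -/y -[Num.sqrt _]/(rho y) /Drho /along_e /e1 /e2 /v /a /=; field.
  by rewrite gt_eqF.
- apply: (is_derive_eq (@der_hypot R (fun s => xA (z s) - xD (z s))
    (fun s => yA (z s) - yD (z s)) t _ _ sep2 xAD yAD)).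
  rewrite -/y -[Num.sqrt _]/(sep y) /DL /along_n /cos_sigma /sin_sigma /d /a /=.
  rewrite -/(sep y); field.
  by rewrite gt_eqF.
- apply: (is_derive_eq (derD (derM xAD xTA) (derM yAD yTA))).
  rewrite -/y /Ddot /along_e /along_n /e1 /e2 /cos_sigma /sin_sigma /d /a /v /=.
  rewrite -/(sep y); field.
  by rewrite !gt_eqF.
Qed.

Lemma lead_derive z t Dr Ds Dd (y := z t) :
  is_derive t 1 (fun s => rho (z s)) Dr -> is_derive t 1 (fun s => sep (z s)) Ds ->
  is_derive t 1 (fun s => dotp (z s)) Dd ->
  is_derive t 1 (fun s => lead alpha (z s)) (Dd - alpha * (Dr * sep y + rho y * Ds)).
Proof.
move=> dr ds dd; rewrite /lead; apply: (is_derive_eq (derB dd (derM (derZ alpha dr) ds))).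
by rewrite /y; ring.
Qed.

Lemma margin_derive z t Dl Ds (y := z t) :
  is_derive t 1 (fun s => lead alpha (z s)) Dl ->
  is_derive t 1 (fun s => sep (z s)) Ds ->
  is_derive t 1 (fun s => margin alpha (z s)) (Dl + (1 - alpha ^+ 2) * sep y * Ds).
Proof.
move=> dl ds; rewrite /margin.
apply: (is_derive_eq (derD dl (derZ _ (derX2 ds)))).
by rewrite /y; field.
Qed.

Lemma marginE y : ~~ contact y ->
  margin alpha y = margin_of alpha (cos_en y) (rho y) (sep y).
Proof.
by move=> nc; have [r0 s0] := no_contactP nc; rewrite /margin /lead dotpE.
Qed.

Lemma leadE y : ~~ contact y -> lead alpha y = lead_of alpha (cos_en y) (rho y) (sep y).
Proof.
by move=> nc; have [r0 s0] := no_contactP nc; rewrite /lead dotpE.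
Qed.

Lemma along_bound y (w : R * R) (M p q s : R) : ~~ contact y ->
  w.1 ^+ 2 + w.2 ^+ 2 = M ^+ 2 -> 0 <= M -> 0 <= s ->
  s ^+ 2 = p ^+ 2 + q ^+ 2 + 2 * p * q * cos_en y ->
  p * along_e y w + q * along_n y w <= M * s.
Proof.
move=> nc ww M0 s0; have [r0 l0] := no_contactP nc.
by apply: dot_bound => //; [exact: unit_e|exact: unit_n].
Qed.

Lemma cos_sin_sqr (b x : R) : (b * cos x) ^+ 2 + (b * sin x) ^+ 2 = b ^+ 2.
Proof. by rewrite !exprMn -mulrDr cos2Dsin2 mulr1. Qed.

(** The four bounds serve in turn to keep the margin nonnegative, to exclude an interception alone,
    to exclude a positive lead forever, and to bound the duration when k <= alpha. The headings of T
    and D enter through [along_bound] only, so phi and psi are arbitrary. *)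
Lemma attacker_motion phi psi z t (y := z t) :
  closed_loop alpha phi (chi_opt alpha) psi z t -> ~~ contact y ->
  exists Dr Ds Dl,
    [/\ is_derive t 1 (fun s => rho (z s)) Dr,
        is_derive t 1 (fun s => sep (z s)) Ds &
        is_derive t 1 (fun s => lead alpha (z s)) Dl] /\
    [/\ forall r, 0 < r -> r <= rho y -> - ((1 + alpha) / r) * `|margin alpha y|
            <= Dl + (1 - alpha ^+ 2) * sep y * Ds,
        forall r, 0 < r -> r <= rho y -> margin alpha y = 0 ->
            Dl + (1 - alpha ^+ 2) * sep y * Ds = 0 ->
            - ((1 + alpha) / r) * sep y <= Ds,
        aim_norm alpha y * lead alpha y <= Dl * rho y - 2 * lead alpha y * Dr &
        cos_en y <= alpha -> exists b, [/\ 0 <= b, sep y * b <= Dl &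
          Dr <= - ((1 - alpha ^+ 2) / 4) + (1 - alpha ^+ 2)^-1 * b]].
Proof.
move=> cl nc; have [r0 l0] := no_contactP nc.
have [chi1 chi2] := chi_optE alpha0 alpha1 nc.
have [dr ds dd] := motion_derive cl nc.
move: dr ds dd; rewrite -/y chi1 chi2.
set v := (alpha * cos (phi y), alpha * sin (phi y)).
set a := (aim_A1 alpha y, aim_A2 alpha y).
set d := (cos (psi y), sin (psi y)).
move=> dr ds dd.
have dl := lead_derive dr ds dd.
have kitv := cos_en_itv r0 l0.
have m0 := aim_norm_gt0 alpha0 alpha1 r0 l0.
have m2 := aim_norm_sqr alpha0 alpha1 r0 l0.
have ee := unit_e r0; have nn := unit_n l0.
have m0' : aim_norm alpha y != 0 by rewrite gt_eqF.
have eaE : along_e y a = (1 - alpha * cos_en y) / aim_norm alpha y.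
  transitivity (((e1 y ^+ 2 + e2 y ^+ 2) - alpha * cos_en y) / aim_norm alpha y).
    by rewrite /along_e /a /aim_A1 /aim_A2 /cos_en /=; field.
  by rewrite ee.
have naE : along_n y a = (cos_en y - alpha) / aim_norm alpha y.
  transitivity ((cos_en y - alpha * (cos_sigma y ^+ 2 + sin_sigma y ^+ 2)) / aim_norm alpha y).
    by rewrite /along_n /a /aim_A1 /aim_A2 /cos_en /=; field.
  by rewrite nn mulr1.
have vb p q s : 0 <= s -> s ^+ 2 = p ^+ 2 + q ^+ 2 + 2 * p * q * cos_en y ->
    p * along_e y v + q * along_n y v <= alpha * s.
  by apply: along_bound => //; [exact: cos_sin_sqr|exact: ltW].
have db p q s : 0 <= s -> s ^+ 2 = p ^+ 2 + q ^+ 2 + 2 * p * q * cos_en y ->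
    p * along_e y d + q * along_n y d <= s.
  move=> s0 sE; rewrite -[leRHS]mul1r; apply: along_bound => //.
  by rewrite /d /= cos2Dsin2 expr1n.
exists (Drho (along_e y v) (along_e y a)), (DL (along_n y d) (along_n y a)),
  (Dlead alpha (rho y) (sep y) (along_e y v) (along_n y v) (along_e y d)
     (along_n y d) (along_e y a) (along_n y a)).
split; first by split.
split.
- move=> r rpos rle; rewrite marginE//.
  exact: (Dmargin_attacker_ge alpha0 alpha1 kitv m0 m2 r0 l0 eaE naE vb db rpos rle).
- move=> r rpos rle; rewrite marginE//.
  exact: (DL_attacker_ge alpha0 alpha1 kitv m0 m2 r0 l0 eaE naE vb db rpos rle).
- rewrite leadE//.
  exact: (Dlead_ratio_ge alpha0 m0 m2 r0 l0 eaE naE vb db).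
move=> ka; exists (alpha * aim_norm alpha y + along_n y v - alpha * along_e y v
    - (1 - alpha ^+ 2) * along_n y a); split.
- exact: (target_gain_ge0 alpha0 alpha1 m0 m2 naE vb ka).
- exact: (Dlead_attacker_ge _ _ _ alpha0 m0 m2 r0 eaE naE db).
- exact: (Drho_attacker_le alpha0 alpha1 kitv m0 m2 eaE naE vb ka).
Qed.

Lemma team_motion chi z t (y := z t) :
  closed_loop alpha (phi_opt alpha) chi (psi_opt alpha) z t -> ~~ contact y ->
  exists2 D, is_derive t 1 (fun s => margin alpha (z s)) D &
    forall l, 0 < l -> l <= sep y -> D <= 2 / l * `|margin alpha y|.
Proof.
move=> cl nc; have [r0 l0] := no_contactP nc.
have [phi1 phi2] := phi_optE alpha0 alpha1 nc.
have [psi1 psi2] := psi_optE alpha0 alpha1 nc.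
have [dr ds dd] := motion_derive cl nc.
move: dr ds dd; rewrite -/y phi1 phi2 psi1 psi2.
set v := (alpha * aim_T1 alpha y, alpha * aim_T2 alpha y).
set a := (cos (chi y), sin (chi y)).
set d := (aim_D1 alpha y, aim_D2 alpha y).
move=> dr ds dd.
have dl := lead_derive dr ds dd.
have dG := margin_derive dl ds.
have kitv := cos_en_itv r0 l0.
have m0 := aim_norm_gt0 alpha0 alpha1 r0 l0.
have m2 := aim_norm_sqr alpha0 alpha1 r0 l0.
have ee := unit_e r0; have nn := unit_n l0.
have m0' : aim_norm alpha y != 0 by rewrite gt_eqF.
have c1E : along_e y v = alpha * ((alpha - cos_en y) / aim_norm alpha y).
  transitivity (alpha * ((alpha * (e1 y ^+ 2 + e2 y ^+ 2) - cos_en y) / aim_norm alpha y)).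
    by rewrite /along_e /v /aim_T1 /aim_T2 /cos_en /=; field.
  by rewrite ee mulr1.
have c2E : along_n y v = alpha * ((alpha * cos_en y - 1) / aim_norm alpha y).
  transitivity (alpha * ((alpha * cos_en y - (cos_sigma y ^+ 2 + sin_sigma y ^+ 2))
     / aim_norm alpha y)); last by rewrite nn.
  by rewrite /along_n /v /aim_T1 /aim_T2 /cos_en /=; field.
have d1E : along_e y d = (1 + (alpha - 2 * cos_en y) * cos_en y) / aim_norm alpha y.
  transitivity (((e1 y ^+ 2 + e2 y ^+ 2) + (alpha - 2 * cos_en y) * cos_en y)
      / aim_norm alpha y).
    by rewrite /along_e /d /aim_D1 /aim_D2 /cos_en /=; field.
  by rewrite ee.
have d2E : along_n y d = (alpha - cos_en y) / aim_norm alpha y.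
  transitivity ((cos_en y + (alpha - 2 * cos_en y) * (cos_sigma y ^+ 2 + sin_sigma y ^+ 2))
     / aim_norm alpha y).
    by rewrite /along_n /d /aim_D1 /aim_D2 /= /cos_en; field.
  by rewrite nn; congr (_ / _); ring.
have ab p q s : 0 <= s -> s ^+ 2 = p ^+ 2 + q ^+ 2 + 2 * p * q * cos_en y ->
    p * along_e y a + q * along_n y a <= s.
  move=> s0 sE; rewrite -[leRHS]mul1r; apply: along_bound => //.
  by rewrite /a /= cos2Dsin2 expr1n.
eexists; first exact: dG.
move=> l lpos lle; rewrite marginE//.
exact: (Dmargin_team_le alpha0 kitv m0 m2 r0 l0 c1E c2E d1E d2E ab lpos lle).
Qed.

End Motion.

(** * Plays under the optimal strategies *)

Section LipschitzExtra.
Variable R : realType.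
Implicit Types (f : R -> R) (a b t : R).

(** A continuous function attains its minimum on [a, b]. This provides the uniform lower bounds on
    rho and L in the Gronwall constants. *)
Lemma lip_pos_bound f a b : a <= b -> lip a b f ->
  (forall t, a <= t -> t <= b -> 0 < f t) ->
  exists2 d, 0 < d & forall t, a <= t -> t <= b -> d <= f t.
Proof.
move=> ab /lip_ge0[C C0 fC] f0.
have fc : {within `[a, b], continuous f}.
  apply/subspace_continuousP => u /=; rewrite in_itv/= => /andP[au ub].
  apply/cvgrPdist_le => e e0.
  have D0 : 0 < e / (C + 1) by rewrite divr_gt0// ltr_wpDl.
  rewrite near_withinE; apply/nbhs_ballP; exists (e / (C + 1)) => //= v.
  rewrite /ball/= => uv; rewrite in_itv/= => /andP[av vb].
  have {uv} uv : (C + 1) * `|u - v| <= e.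
    by rewrite mulrC -ler_pdivlMr ?ltW// ltr_wpDl.
  have h : C * `|u - v| <= (C + 1) * `|u - v| by rewrite ler_wpM2r// lerDl.
  apply: le_trans (le_trans h uv); have [uv'|vu] := leP u v.
    by rewrite distrC (distrC u) [X in _ <= _ * X]ger0_norm ?subr_ge0// fC.
  by rewrite [X in _ <= _ * X]gtr0_norm ?subr_gt0// fC// ltW.
have [c cab cmin] := EVT_min ab fc.
move: cab; rewrite in_itv/= => /andP[ac cb].
exists (f c); first exact: f0.
by move=> t at_ tb; apply: cmin; rewrite in_itv/= at_.
Qed.

Lemma derive_locally_zero f a b t D : (forall s, a < s -> s < b -> f s = 0) ->
  a < t -> t < b -> is_derive t 1 f D -> D = 0.
Proof.
move=> f0 at_ tb /is_derive_epsP Df.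
apply/eqP; rewrite -normr_le0; apply/ler_addgt0Pr => e e0; rewrite add0r.
have [d d0 Hd] := Df e e0.
pose h := Num.min (d / 2) ((b - t) / 2).
have h0 : 0 < h by rewrite lt_min !divr_gt0// subr_gt0.
have hd : h <= d / 2 by rewrite ge_min lexx.
have hb : h <= (b - t) / 2 by rewrite ge_min lexx orbT.
have := Hd h; rewrite gtr0_norm// => /(_ _).
rewrite (f0 t)// (f0 (t + h)); [|by move: at_ h0; lra|by move: tb hb; lra].
rewrite subrr sub0r normrN normrM (gtr0_norm h0) ler_pM2r//; apply.
by move: d0 hd; lra.
Qed.

End LipschitzExtra.

Section Plays.
Variables (R : realType) (alpha : R).
Hypothesis alpha0 : 0 < alpha.
Hypothesis alpha1 : alpha < 1.
Implicit Types (x y : state R) (z : R -> state R) (t : R) (tf : \bar R).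

Let a2 : 0 < 1 - alpha ^+ 2.
Proof. by rewrite subr_gt0 expr_lt1// ltW. Qed.

Section OnePlay.
Variables (x : state R) (phi chi psi : state R -> R) (z : R -> state R) (tf : \bar R).
Hypothesis pl : play alpha x phi chi psi z tf.

Lemma play_coord_lip (p : state R -> R) :
  (forall y y', p (y - y') = p y - p y') -> (forall y, `|p y| <= `|y|) ->
  forall b : R, (b%:E <= tf)%E -> lip 0 b (fun t => p (z t)).
Proof.
move=> pB p1 b btf; have [_ zl _ _ _] := pl; exists 1 => s t s0 st tb.
rewrite -pB mul1r; apply: (le_trans (p1 _)); apply: zl => //.
by apply: le_trans btf; rewrite lee_fin.
Qed.

Section UpTo.
Variable b : R.
Hypothesis btf : (b%:E <= tf)%E.

Let xTl : lip 0 b (fun t => xT (z t)).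
Proof. by apply: (@play_coord_lip (@xT R)) => // y; exact: norm_xT. Qed.
Let yTl : lip 0 b (fun t => yT (z t)).
Proof. by apply: (@play_coord_lip (@yT R)) => // y; exact: norm_yT. Qed.
Let xAl : lip 0 b (fun t => xA (z t)).
Proof. by apply: (@play_coord_lip (@xA R)) => // y; exact: norm_xA. Qed.
Let yAl : lip 0 b (fun t => yA (z t)).
Proof. by apply: (@play_coord_lip (@yA R)) => // y; exact: norm_yA. Qed.
Let xDl : lip 0 b (fun t => xD (z t)).
Proof. by apply: (@play_coord_lip (@xD R)) => // y; exact: norm_xD. Qed.
Let yDl : lip 0 b (fun t => yD (z t)).
Proof. by apply: (@play_coord_lip (@yD R)) => // y; exact: norm_yD. Qed.

Lemma rho_lip : lip 0 b (fun t => rho (z t)).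
Proof.
exact: (lip_hypot (lipB xTl xAl) (lipB yTl yAl)).
Qed.

Lemma sep_lip : lip 0 b (fun t => sep (z t)).
Proof.
exact: (lip_hypot (lipB xAl xDl) (lipB yAl yDl)).
Qed.

Lemma lead_lip : lip 0 b (fun t => lead alpha (z t)).
Proof.
apply: lipB.
  by apply: lipD; apply: lipM; exact: lipB.
apply: lipM; last exact: sep_lip.
by apply: lipM; [exact: lip_cst|exact: rho_lip].
Qed.

Lemma margin_lip : lip 0 b (fun t => margin alpha (z t)).
Proof.
apply: lipD; first exact: lead_lip.
by apply: lipM; [exact: lip_cst|apply: lipX2; exact: sep_lip].
Qed.

Lemma play_ae : {ae lebesgue_measure, forall t : R, 0 < t -> t < b ->
  closed_loop alpha phi chi psi z t /\ ~~ contact (z t)}.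
Proof.
have [_ _ cl nc _] := pl; apply: ae_imply cl => t clt t0 tb.
have ttf : (t%:E < tf)%E by apply: lt_le_trans btf; rewrite lte_fin.
split; first exact: clt.
by rewrite /contact negb_or; apply/andP; apply: nc => //; exact: ltW.
Qed.

End UpTo.

(** Each of the four coordinates of A and D moves by at most t, and the distance changes by at most
    the sum of these moves. *)
Lemma sep_growth t : 0 <= t -> (t%:E <= tf)%E -> sep (z t) <= sep x + 4 * t.
Proof.
move=> t0 ttf; have [[_ z0] zl _ _ _] := pl.
have := zl 0 t (lexx _) t0 ttf; rewrite z0 subr0 => zt.
have c (p : state R -> R) : (forall y y', p (y - y') = p y - p y') ->
    (forall y, `|p y| <= `|y|) -> `|p (z t) - p x| <= t.
  by move=> pB p1; rewrite -pB; exact: le_trans (p1 _) zt.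
have h1 := c (@xA R) (fun _ _ => erefl) (@norm_xA R).
have h2 := c (@xD R) (fun _ _ => erefl) (@norm_xD R).
have h3 := c (@yA R) (fun _ _ => erefl) (@norm_yA R).
have h4 := c (@yD R) (fun _ _ => erefl) (@norm_yD R).
have key (u v u' v' : R) : `|u - u'| <= t -> `|v - v'| <= t ->
    `|(u - v) - (u' - v')| <= 2 * t.
  have -> : u - v - (u' - v') = (u - u') - (v - v') by ring.
  by move=> hu hv; apply: (le_trans (ler_normB _ _)); lra.
have := sqrt_sum_sq_dist (xA (z t) - xD (z t)) (yA (z t) - yD (z t))
  (xA x - xD x) (yA x - yD x).
rewrite -[Num.sqrt ((xA (z t) - _) ^+ 2 + _)]/(sep (z t)).
rewrite -[Num.sqrt ((xA x - _) ^+ 2 + _)]/(sep x) => h5.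
have := key _ _ _ _ h1 h2; have := key _ _ _ _ h3 h4.
by move: h5; rewrite ler_norml => /andP[_]; lra.
Qed.

End OnePlay.

Lemma dotp_captured y : captured y -> dotp y = 0.
Proof.
move=> /eqP AT; rewrite /dotp /xA /yA /xT /yT AT !subrr !mulr0.
exact: addr0.
Qed.

Lemma dotp_intercepted y : intercepted y -> dotp y = 0.
Proof.
move=> /eqP AD; rewrite /dotp /xA /yA /xD /yD AD !subrr !mul0r.
exact: addr0.
Qed.

Lemma team_guarantee x chi z (t : R) : margin alpha x <= 0 ->
  play alpha x (phi_opt alpha) chi (psi_opt alpha) z t%:E -> intercepted (z t).
Proof.
move=> sx pl; have [[t0 z0] _ _ nc ct] := pl; rewrite lee_fin in t0.
(* Otherwise A and D stay apart on the whole closed interval, and [sep] has a positive minimum on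
   it. *)
apply/negPn/negP => ni.
have cap : captured (z t) by have := ct t erefl; rewrite (negbTE ni) orbF.
have sep_pos s : 0 <= s -> s <= t -> 0 < sep (z s).
  move=> s0 st; rewrite lt_neqAle sep_ge0 andbT eq_sym -intercepted_sep.
  move: st; rewrite le_eqVlt => /orP[/eqP->//|st].
  by have [] := nc s s0; rewrite ?lte_fin.
have tt : (t%:E <= t%:E)%E by [].
have [d d0 dsep] := lip_pos_bound t0 (sep_lip pl tt) sep_pos.
have : 0 <= - margin alpha (z t).
  apply: (@gronwall_ge0 R (fun s => - margin alpha (z s)) 0 t (2 / d)) => //.
  - by apply: lipN; exact: margin_lip pl _ tt.
  - by rewrite z0 oppr_ge0.
  apply: ae_imply (play_ae pl tt) => s H s0 st; have [cl ncs] := H s0 st.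
  have [D DG DD] := team_motion alpha0 alpha1 cl ncs.
  exists (- D); first exact: is_deriveN.
  by rewrite mulNr lerN2 normrN; apply: DD => //; apply: dsep; exact: ltW.
(* At a capture [dotp] and [rho] vanish, which leaves the positive term in [sep]. *)
apply/negP; rewrite -ltNge oppr_lt0 /margin /lead dotp_captured//.
have /eqP -> : rho (z t) == 0 by rewrite -captured_rho.
by rewrite mulr0 mul0r subr0 add0r mulr_gt0 ?divr_gt0// exprn_gt0// sep_pos.
Qed.

(** * What the Attacker enforces from a nonnegative margin *)

Section Attacker.
Variables (x : state R) (phi psi : state R -> R) (z : R -> state R) (tf : \bar R).
Hypothesis margin_x : 0 <= margin alpha x.
Hypothesis sep_x : 0 < sep x.
Hypothesis pl : play alpha x phi (chi_opt alpha) psi z tf.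

Let z0 : z 0 = x. Proof. by have [[]] := pl. Qed.

Let margin_gronwall (s t r : R) : 0 <= s -> s <= t -> (t%:E <= tf)%E -> 0 < r ->
  (forall u, s <= u -> u <= t -> r <= rho (z u)) ->
  lip s t (fun u => margin alpha (z u)) /\
  {ae lebesgue_measure, forall u : R, s < u -> u < t ->
    exists2 l, is_derive u 1 (fun u => margin alpha (z u)) l &
      - ((1 + alpha) / r) * `|margin alpha (z u)| <= l}.
Proof.
move=> s0 st ttf r0 rr; split.
  by apply: (@lip_sub R 0 t) => //; exact: margin_lip pl _ ttf.
apply: ae_imply (play_ae pl ttf) => u H su ut.
have [cl ncs] := H (le_lt_trans s0 su) ut.
have [Dr [Ds [Dl [[dr ds dl] [h _ _ _]]]]] := attacker_motion alpha0 alpha1 cl ncs.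
exists (Dl + (1 - alpha ^+ 2) * sep (z u) * Ds); first exact: margin_derive.
by apply: h => //; apply: rr; exact: ltW.
Qed.

Lemma margin_stays_ge0 (t : R) : 0 <= t -> (t%:E <= tf)%E ->
  (forall u, 0 <= u -> u <= t -> 0 < rho (z u)) -> 0 <= margin alpha (z t).
Proof.
move=> t0 ttf rpos; have [r r0 rr] := lip_pos_bound t0 (rho_lip pl ttf) rpos.
have [sl sae] := margin_gronwall (lexx 0) t0 ttf r0 rr.
by apply: (gronwall_ge0 t0 sl) sae; rewrite z0.
Qed.

Lemma attacker_not_intercepted_first (t : R) : tf = t%:E -> captured (z t).
Proof.
move=> tfE; have [[t0 _] _ _ nc ct] := pl; rewrite tfE lee_fin in t0.
apply/negPn/negP => nca.
have int : intercepted (z t) by have := ct t tfE; rewrite (negbTE nca).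
have ttf : (t%:E <= tf)%E by rewrite tfE.
have rpos s : 0 <= s -> s <= t -> 0 < rho (z s).
  move=> s0 st; rewrite lt_neqAle rho_ge0 andbT eq_sym -captured_rho.
  move: st; rewrite le_eqVlt => /orP[/eqP->//|st].
  by have [] := nc s s0; rewrite ?tfE ?lte_fin.
have [r r0 rr] := lip_pos_bound t0 (rho_lip pl ttf) rpos.
have sept : sep (z t) = 0 by apply/eqP; rewrite -intercepted_sep.
have margint : margin alpha (z t) = 0.
  by rewrite /margin /lead dotp_intercepted// sept mulr0 subrr expr0n mulr0 addr0.
(* A margin positive at some time would remain positive until t, where it is 0. *)
have margin0 s : 0 <= s -> s <= t -> margin alpha (z s) = 0.
  move=> s0 st; apply/eqP; rewrite eq_le; apply/andP; split; last first.
    apply: margin_stays_ge0 => //; first by apply: le_trans ttf; rewrite lee_fin.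
    by move=> u u0 us; apply: rpos => //; exact: le_trans st.
  rewrite leNgt; apply/negP => margins.
  have rr' u : s <= u -> u <= t -> r <= rho (z u).
    by move=> su ut; apply: rr => //; exact: le_trans su.
  have [sl sae] := margin_gronwall s0 st ttf r0 rr'.
  by have := gronwall_gt0 st sl margins sae; rewrite margint ltxx.
(* The margin and its derivative vanish throughout, so [sep] decreases at most exponentially and
   cannot reach 0. *)
have : 0 < sep (z t).
  apply: (@gronwall_gt0 R (fun s => sep (z s)) 0 t ((1 + alpha) / r)) => //.
  - exact: sep_lip pl _ ttf.
  - by rewrite z0.
  apply: ae_imply (play_ae pl ttf) => u H u0 ut; have [cl ncu] := H u0 ut.
  have [Dr [Ds [Dl [[dr ds dl] [_ h _ _]]]]] := attacker_motion alpha0 alpha1 cl ncu.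
  exists Ds => //; rewrite ger0_norm ?sep_ge0//; apply: h => //.
  - by apply: rr; exact: ltW.
  - by apply: margin0; exact: ltW.
  apply: (@derive_locally_zero R (fun s => margin alpha (z s)) 0 t u) => //.
    by move=> s s0 st; apply: margin0; exact: ltW.
  exact: margin_derive.
by rewrite sept ltxx.
Qed.

(** * Exclusion of plays of infinite duration *)

Section Endless.
Hypothesis tfE : tf = +oo%E.

Let le_tf (t : R) : (t%:E <= tf)%E. Proof. by rewrite tfE leey. Qed.

Let nct (t : R) : 0 <= t -> ~~ contact (z t).
Proof.
move=> t0; have [_ _ _ nc _] := pl.
by rewrite /contact negb_or; apply/andP; apply: nc => //; rewrite tfE ltry.
Qed.

Let rpos (t : R) : 0 <= t -> 0 < rho (z t).
Proof. by move=> /nct /no_contactP[]. Qed.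

Let spos (t : R) : 0 <= t -> 0 < sep (z t).
Proof. by move=> /nct /no_contactP[]. Qed.

Lemma endless_lead_le0 (t : R) : 0 <= t -> lead alpha (z t) <= 0.
Proof.
move=> t0; rewrite leNgt; apply/negP => lead0.
(* Positivity is propagated for lead / rho^2, whose derivative is at least m / rho times itself; m
   <= 2 gives the constant 2 / r. *)
have lead_pos (b : R) : t <= b -> 0 < lead alpha (z b).
  move=> tb.
  have rpos' s : t <= s -> s <= b -> 0 < rho (z s).
    by move=> ts _; apply: rpos; exact: le_trans ts.
  have rl : lip t b (fun s => rho (z s)) by apply: lip_sub (rho_lip pl (le_tf b)).
  have [r r0 rr] := lip_pos_bound tb rl rpos'.
  have r2l : lip t b (fun s => (rho (z s) ^+ 2)^-1).
    apply: (@lipV R t b _ (r ^+ 2)); [exact: exprn_gt0| |exact: lipX2].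
    by move=> s ts sb; rewrite ler_pXn2r ?nnegrE ?rr// ?(ltW r0)// rho_ge0.
  have : 0 < lead alpha (z b) * (rho (z b) ^+ 2)^-1.
    apply: (@gronwall_gt0 R (fun s => lead alpha (z s) * (rho (z s) ^+ 2)^-1) t b
              (2 / r)) => //.
    - by apply: lipM => //; apply: lip_sub (lead_lip pl (le_tf b)).
    - by rewrite mulr_gt0// invr_gt0 exprn_gt0// rpos.
    apply: ae_imply (play_ae pl (le_tf b)) => u H tu ub.
    have u0 := le_lt_trans t0 tu; have [cl ncu] := H u0 ub.
    have ru := rpos (ltW u0); have su := spos (ltW u0).
    have [Dr [Ds [Dl [[dr ds dl] [_ _ h _]]]]] :=
      attacker_motion alpha0 alpha1 cl ncu.
    have r2u : rho (z u) ^+ 2 != 0 by rewrite gt_eqF// exprn_gt0.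
    have dr2V := @derV R (fun s => rho (z s) ^+ 2) u _ r2u (derX2 dr).
    eexists; first exact: (derM dl dr2V).
    rewrite /=.
    have -> : Dl * (rho (z u) ^+ 2)^-1 +
        lead alpha (z u) * (- (2 * rho (z u) * Dr) / (rho (z u) ^+ 2) ^+ 2) =
        (Dl * rho (z u) - 2 * lead alpha (z u) * Dr) / rho (z u) ^+ 3.
      by field; rewrite gt_eqF.
    apply: (@le_trans _ _ (aim_norm alpha (z u) * lead alpha (z u)
      / rho (z u) ^+ 3)); last first.
      by rewrite ler_pM2r// invr_gt0 exprn_gt0.
    have -> : aim_norm alpha (z u) * lead alpha (z u) / rho (z u) ^+ 3 =
      aim_norm alpha (z u) / rho (z u) * (lead alpha (z u) * (rho (z u) ^+ 2)^-1).
      by field; rewrite gt_eqF.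
    set w := lead alpha (z u) * _.
    have mr : 0 <= aim_norm alpha (z u) / rho (z u) by rewrite divr_ge0 ?sqrtr_ge0// ltW.
    have mr2 : aim_norm alpha (z u) / rho (z u) <= 2 / r.
      apply: ler_pM; rewrite ?sqrtr_ge0 ?invr_ge0 ?(ltW ru)//.
        exact: (m_le2 alpha0 alpha1 (cos_en_itv ru su) (aim_norm_sqr alpha0 alpha1 ru su)).
      by rewrite lef_pV2 ?posrE// rr// ltW.
    have h1 : - (aim_norm alpha (z u) / rho (z u)) * `|w|
      <= aim_norm alpha (z u) / rho (z u) * w.
      by rewrite mulNr -mulrN ler_wpM2l// lerNl (le_trans (ler_norm _))// normrN.
    apply: le_trans h1; rewrite !mulNr lerN2 ler_wpM2r//.
  by rewrite pmulr_lgt0// invr_gt0 exprn_gt0// rpos// (le_trans t0).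
pose l (s : R) := sep x + 4 * s.
have l_pos s : 0 <= s -> 0 < l s by move=> s0; rewrite ltr_wpDr// mulr_ge0.
(* The first term decreases at least at rate 1 / l because [sep] is at most l; the second grows
   exactly at that rate, since l' = 4. *)
pose psi0 (s : R) := rho (z s) ^+ 2 * (lead alpha (z s))^-1 + 4^-1 * ln (l s).
have psi_le (b : R) : t <= b -> psi0 b <= psi0 t.
  move=> tb; rewrite -lerN2.
  have [d d0 dd] := lip_pos_bound tb (lip_sub t0 (lexx b) (lead_lip pl (le_tf b)))
    (fun s ts _ => lead_pos s ts).
  apply: (@lip_ae_nondecreasing R (fun s => - psi0 s)) => //.
    apply: lipN; apply: lipD.
      apply: lipM; first by apply: lipX2; apply: lip_sub (rho_lip pl (le_tf b)).
      by apply: (@lipV R t b _ d) => //; apply: lip_sub (lead_lip pl (le_tf b)).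
    apply: lipM; first exact: lip_cst.
    apply: (@lip_ln R t b _ (sep x)) => //.
      by move=> s ts _; rewrite /l lerDl mulr_ge0// (le_trans t0).
    by apply: lipD; [exact: lip_cst|apply: lipM; [exact: lip_cst|exact: lip_id]].
  apply: ae_imply (play_ae pl (le_tf b)) => u H tu ub.
  have u0 := le_lt_trans t0 tu; have [cl ncu] := H u0 ub.
  have ru := rpos (ltW u0); have su := spos (ltW u0).
  have lu := lead_pos u (ltW tu).
  have [Dr [Ds [Dl [[dr ds dl] [_ _ h _]]]]] := attacker_motion alpha0 alpha1 cl ncu.
  have lu' : lead alpha (z u) != 0 by rewrite gt_eqF.
  have dl4 : is_derive u 1 l 4.
    apply: (is_derive_eq (derD (derC u (sep x)) (derZ 4 (is_derive_id u 1)))).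
    by rewrite add0r mulr1.
  have lu0 := l_pos u (ltW u0).
  eexists.
    have dlV := @derV R (fun s => lead alpha (z s)) u _ lu' dl.
    apply: is_deriveN.
    exact: (derD (derM (derX2 dr) dlV) (derZ 4^-1 (@der_ln R l u 4 lu0 dl4))).
  rewrite oppr_ge0.
  have -> : 2 * rho (z u) * Dr * (lead alpha (z u))^-1 +
     rho (z u) ^+ 2 * (- Dl / lead alpha (z u) ^+ 2) + 4^-1 * (4 / l u) =
     (l u)^-1 - rho (z u) * (Dl * rho (z u) - 2 * lead alpha (z u) * Dr)
       / lead alpha (z u) ^+ 2.
    by field; rewrite lu' gt_eqF.
  rewrite subr_le0.
  apply: (@le_trans _ _ (rho (z u) * (aim_norm alpha (z u) * lead alpha (z u))
     / lead alpha (z u) ^+ 2)); last first.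
    by rewrite ler_pM2r ?invr_gt0 ?exprn_gt0// ler_pM2l.
  have -> : rho (z u) * (aim_norm alpha (z u) * lead alpha (z u)) / lead alpha (z u) ^+ 2
     = rho (z u) * aim_norm alpha (z u) / lead alpha (z u) by field.
  (* Since lead = rho sep (k - alpha) and k - alpha <= 1 - alpha <= m, the quotient rho m / lead is
     at least 1 / sep. *)
  apply: (@le_trans _ _ (sep (z u))^-1).
    by rewrite lef_pV2 ?posrE// (sep_growth pl (ltW u0) (le_tf u)).
  rewrite ler_pdivlMr// mulrC ler_pdivrMr// leadE// /lead_of.
  have kitv := cos_en_itv ru su; have /andP[_ k1] := kitv.
  have mge := m_ge alpha0 kitv (aim_norm_gt0 alpha0 alpha1 ru su)
    (aim_norm_sqr alpha0 alpha1 ru su).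
  have -> : rho (z u) * sep (z u) * cos_en (z u) - alpha * rho (z u) * sep (z u) =
    rho (z u) * (cos_en (z u) - alpha) * sep (z u) by ring.
  rewrite ler_pM2r// ler_pM2l//.
  by move: mge k1; lra.
(* At this time the logarithmic term alone exceeds psi0 t. *)
pose b := t + expR (4 * psi0 t + 1).
have tb : t <= b by rewrite /b lerDl expR_ge0.
have b0 := le_trans t0 tb.
have := psi_le b tb.
have h1 : 0 <= rho (z b) ^+ 2 * (lead alpha (z b))^-1.
  by rewrite mulr_ge0 ?sqr_ge0// invr_ge0 ltW// lead_pos.
have h2 : 4 * psi0 t + 1 <= ln (l b).
  rewrite -[leLHS]expRK ler_ln ?posrE ?expR_gt0 ?l_pos//.
  have := expR_ge0 (4 * psi0 t + 1); rewrite /l /b.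
  by move: t0 (sep_x); lra.
by rewrite {1}/psi0; move: h1 h2; lra.
Qed.

Lemma not_endless : False.
Proof.
have kle (t : R) : 0 <= t -> cos_en (z t) <= alpha.
  move=> t0; have := endless_lead_le0 t0; rewrite leadE ?nct// /lead_of.
  have -> : rho (z t) * sep (z t) * cos_en (z t) - alpha * rho (z t) * sep (z t) =
    rho (z t) * sep (z t) * (cos_en (z t) - alpha) by ring.
  by rewrite pmulr_rle0 ?subr_le0// mulr_gt0 ?rpos ?spos.
pose K := (1 - alpha ^+ 2)^-1; pose c := (1 - alpha ^+ 2) / 4.
have K0 : 0 < K by rewrite invr_gt0.
have c0 : 0 < c by rewrite divr_gt0.
have lead_mono (s t : R) : 0 <= s -> s <= t ->
    lead alpha (z s) <= lead alpha (z t).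
  move=> s0 st; apply: (@lip_ae_nondecreasing R (fun s => lead alpha (z s))) => //.
    by apply: lip_sub (lead_lip pl (le_tf t)).
  apply: ae_imply (play_ae pl (le_tf t)) => u H su ut.
  have u0 := le_lt_trans s0 su; have [cl ncu] := H u0 ut.
  have [Dr [Ds [Dl [[dr ds dl] [_ _ _ h]]]]] := attacker_motion alpha0 alpha1 cl ncu.
  exists Dl => //; have [v [v0 hv _]] := h (kle u (ltW u0)).
  by apply: le_trans hv; rewrite mulr_ge0// ltW// spos// ltW.
(* The square root of - lead is not differentiable where lead vanishes. In that case lead,
   nondecreasing and at most 0, is 0 from then on, and rho decreases at rate c. *)
have [[t [t0 lt0]]|lead_neg] := pselect (exists t, 0 <= t /\ lead alpha (z t) = 0).
  (* A decrease at rate c from time t would make rho at most -1 at time b. *)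
  pose b := t + (rho (z t) + 1) / c.
  have tb : t <= b by rewrite /b lerDl divr_ge0 ?addr_ge0 ?rho_ge0// ltW.
  have lead0 s : t <= s -> lead alpha (z s) = 0.
    move=> ts; apply/eqP; rewrite eq_le (endless_lead_le0 (le_trans t0 ts)) /=.
    by have := lead_mono t s t0 ts; rewrite lt0.
  have : - (rho (z t) + c * t) <= - (rho (z b) + c * b).
    apply: (@lip_ae_nondecreasing R (fun s => - (rho (z s) + c * s))) => //.
      apply: lipN; apply: lipD; first by apply: lip_sub (rho_lip pl (le_tf b)).
      by apply: lipM; [exact: lip_cst|exact: lip_id].
    apply: ae_imply (play_ae pl (le_tf b)) => u H tu ub.
    have u0 := le_lt_trans t0 tu; have [cl ncu] := H u0 ub.
    have [Dr [Ds [Dl [[dr ds dl] [_ _ _ h]]]]] :=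
      attacker_motion alpha0 alpha1 cl ncu.
    eexists; first exact: (is_deriveN (derD dr (derZ c (is_derive_id u 1)))).
    have [v [v0 hv hr]] := h (kle u (ltW u0)).
    have Dl0 : Dl = 0.
      apply: (@derive_locally_zero R (fun s => lead alpha (z s)) t b u) => //.
      by move=> s ts _; apply: lead0; exact: ltW.
    have v00 : v <= 0 by rewrite -(pmulr_rle0 _ (spos (ltW u0))) -Dl0.
    have Kv : K * v <= 0 by rewrite pmulr_rle0.
    by rewrite oppr_ge0 mulr1; move: hr Kv; rewrite -/K -/c; lra.
  have bE : c * b = c * t + (rho (z t) + 1).
    by rewrite /b mulrDr (mulrC c (_ / c)) divfK// gt_eqF.
  by rewrite bE; have := rho_ge0 (z b); lra.
have lneg (t : R) : 0 <= t -> 0 < - lead alpha (z t).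
  move=> t0; rewrite oppr_gt0 lt_neqAle endless_lead_le0// andbT.
  by apply/eqP => l0; apply: lead_neg; exists t.
(* The gain K v by which T delays capture is paid for by lead: v <= Dl / sep <= Dl / q with q =
   sqrt(- lead), and K Dl / q is minus the derivative of 2 K sqrt(- lead). *)
pose Phi (s : R) := rho (z s) + 2 * K * Num.sqrt (- lead alpha (z s)) + c * s.
pose b := (Phi 0 + 1) / c.
have Phi0 : 0 <= Phi 0.
  by rewrite /Phi mulr0 addr0 addr_ge0 ?rho_ge0// !mulr_ge0 ?sqrtr_ge0// ltW.
have b0 : 0 <= b by apply: divr_ge0; [exact: addr_ge0|exact: ltW].
have nlip : lip 0 b (fun s => - lead alpha (z s)).
  by apply: lipN; exact: lead_lip pl _ (le_tf b).
have : - Phi 0 <= - Phi b.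
  have [d d0 dd] := lip_pos_bound b0 nlip (fun s s0 _ => lneg s s0).
  apply: (@lip_ae_nondecreasing R (fun s => - Phi s)) => //.
    apply: lipN; apply: lipD; last by apply: lipM; [exact: lip_cst|exact: lip_id].
    apply: lipD; first exact: rho_lip pl _ (le_tf b).
    apply: lipM; first exact: lip_cst.
    exact: (@lip_sqrt R 0 b _ d).
  apply: ae_imply (play_ae pl (le_tf b)) => u H u0 ub; have [cl ncu] := H u0 ub.
  have [Dr [Ds [Dl [[dr ds dl] [_ _ _ h]]]]] := attacker_motion alpha0 alpha1 cl ncu.
  have lu := lneg u (ltW u0); have su := spos (ltW u0).
  eexists.
    exact: (is_deriveN (derD (derD dr (derZ (2 * K)
      (@der_sqrt R (fun s => - lead alpha (z s)) u _ lu (is_deriveN dl))))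
      (derZ c (is_derive_id u 1)))).
  have [v [v0 hv hr]] := h (kle u (ltW u0)).
  set q := Num.sqrt (- lead alpha (z u)).
  have q0 : 0 < q by rewrite sqrtr_gt0.
  (* A nonnegative margin gives - lead <= (1 - alpha^2) / 2 sep^2 <= sep^2. *)
  have qs : q <= sep (z u).
    apply: le_of_sqr; first exact: ltW.
    rewrite sqr_sqrtr ?(ltW lu)//.
    have : 0 <= margin alpha (z u).
      by apply: margin_stays_ge0 => //; [exact: ltW|move=> ? ? _; exact: rpos].
    have : (1 - alpha ^+ 2) / 2 * sep (z u) ^+ 2 <= 1 * sep (z u) ^+ 2.
      by rewrite ler_wpM2r ?sqr_ge0//; have := sqr_ge0 alpha; lra.
    by rewrite /margin; lra.
  have h1 : K * v <= K * (Dl / q).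
    rewrite ler_pM2l// ler_pdivlMr//; apply: le_trans hv.
    by rewrite mulrC ler_wpM2r.
  have -> : 2 * K * (- Dl / (2 * q)) = - (K * (Dl / q)) by field; rewrite gt_eqF.
  by rewrite oppr_ge0 mulr1; move: hr h1; rewrite -/K -/c; lra.
have bE : c * b = Phi 0 + 1 by rewrite /b mulrC divfK// gt_eqF.
have : 0 <= rho (z b) + 2 * K * Num.sqrt (- lead alpha (z b)).
  by rewrite addr_ge0 ?rho_ge0// !mulr_ge0 ?sqrtr_ge0// ltW.
by rewrite {2}/Phi bE; lra.
Qed.

End Endless.

Lemma attacker_guarantee : exists2 t : R, tf = t%:E & captured (z t).
Proof.
have [[tf0 _] _ _ _ _] := pl.
have [tE|[tE|[t tE]]] : tf = -oo%E \/ tf = +oo%E \/ exists t : R, tf = t%:E.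
- by case: tf => [t| |]; [right; right; exists t|right; left|left].
- by rewrite tE in tf0.
- by case: (not_endless tE).
- by exists t => //; exact: attacker_not_intercepted_first.
Qed.

End Attacker.
End Plays.

(** * The games on the barrier *)

Section BarrierGame.
Variables (R : realType) (alpha : R).
Hypothesis alpha0 : 0 < alpha.
Hypothesis alpha1 : alpha < 1.
Implicit Types (x : state R) (z : R -> state R) (tf : \bar R).

(** X / (1 - alpha^2) is the signed distance from the bisector of AD to the centre of the Apollonius
    disc of T and A, whose radius is alpha rho / (1 - alpha^2). Thus B = X^2 - (alpha rho)^2
    vanishes at tangency from either side. As margin = sep (X - alpha rho), the root X = alpha rho
    is the claim; the other one is excluded by T being closer to A than to D. *)
Lemma barrier_margin x : Barrier alpha x -> margin alpha x = 0 /\ 0 < sep x.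
Proof.
move=> [nRed B0].
have AT_lt_DT : dist (posA x) (posT x) < dist (posD x) (posT x).
  by rewrite ltNge; apply/negP => h; apply: nRed; rewrite /Red /= subr_ge0.
have sep0 : 0 < sep x.
  rewrite lt_neqAle sep_ge0 andbT eq_sym -intercepted_sep.
  by apply/negP => /eqP AD; move: AT_lt_DT; rewrite AD ltxx.
split=> //; have nn := unit_n sep0.
have rho2 := dist_sqr (posT x) (posA x); rewrite -/(rho x) /= in rho2.
have sep2 := dist_sqr (posA x) (posD x); rewrite -/(sep x) /= in sep2.
pose X := (xT x - (alpha ^+ 2 * xA x + (1 - alpha ^+ 2) * x0 x)) * cos_sigma x
        + (yT x - (alpha ^+ 2 * yA x + (1 - alpha ^+ 2) * y0 x)) * sin_sigma x.
(* The last summand is the remainder modulo n being a unit vector. *)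
have BE : B alpha x = X ^+ 2 - alpha ^+ 2 * rho x ^+ 2
    + 2 * alpha ^+ 2 * (xA x * xT x + yA x * yT x)
      * (cos_sigma x ^+ 2 + sin_sigma x ^+ 2 - 1).
  rewrite rho2 -/(xT x) -/(yT x) -/(xA x) -/(yA x).
  by rewrite /B /bxx /byy /bxy /bx /by_ /b /X; ring.
have X2 : X ^+ 2 = (alpha * rho x) ^+ 2.
  by rewrite exprMn; apply/eqP; rewrite -subr_eq0 -B0 BE nn subrr mulr0 addr0.
have sepX : sep x * X = dotp x + (1 - alpha ^+ 2) / 2 * sep x ^+ 2.
  rewrite sep2 -/(xA x) -/(yA x) -/(xD x) -/(yD x).
  rewrite /X /dotp /cos_sigma /sin_sigma /x0 /y0 -/(sep x); field.
  by rewrite gt_eqF.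
(* From |T - D|^2 = rho^2 + sep^2 + 2 [dotp]. *)
have dot_gt : - (sep x ^+ 2 / 2) < dotp x.
  have : dist (posA x) (posT x) ^+ 2 < dist (posD x) (posT x) ^+ 2.
    by rewrite ltr_pXn2r// nnegrE dist_ge0.
  rewrite !dist_sqr /dotp /xA /yA /xD /yD /xT /yT !expr2; lra.
have dot_le : - (rho x * sep x) <= dotp x.
  have := @dot_bound R (cos_sigma x) (sin_sigma x) (cos_sigma x) (sin_sigma x)
    (xA x - xT x) (yA x - yT x) (rho x) 1 0 1 nn nn.
  rewrite rho2 -/(xA x) -/(yA x) -/(xT x) -/(yT x).
  move=> /(_ ltac:(ring) (rho_ge0 x) ler01 ltac:(ring)).
  rewrite mul1r mul0r addr0 mulr1 => h.
  have : sep x * (cos_sigma x * (xA x - xT x) + sin_sigma x * (yA x - yT x))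
     <= sep x * rho x by rewrite ler_pM2l.
  have -> : sep x * (cos_sigma x * (xA x - xT x)
      + sin_sigma x * (yA x - yT x)) = - dotp x.
    rewrite /dotp /cos_sigma /sin_sigma -/(sep x); field.
    by rewrite gt_eqF.
  by rewrite mulrC; lra.
have marginX : margin alpha x = sep x * (X - alpha * rho x).
  by rewrite mulrBr sepX /margin /lead; ring.
move/eqP: X2; rewrite eqf_sqr => /orP[/eqP XE|/eqP XE].
  by rewrite marginX XE subrr mulr0.
exfalso; rewrite XE in sepX.
(* With X = - alpha rho, (1 - alpha) [dotp] would be above - (1 - alpha) / 2 sep^2 and at most - (1
   - alpha^2) / 2 sep^2, which is smaller. *)
have h1 : alpha * - (rho x * sep x) <= alpha * dotp x by rewrite ler_pM2l.
have h2 : (1 - alpha) * - (sep x ^+ 2 / 2) < (1 - alpha) * dotp x.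
  by rewrite ltr_pM2l// subr_gt0.
have h3 : (1 - alpha) * dotp x <= - ((1 - alpha ^+ 2) / 2 * sep x ^+ 2).
  by move: sepX h1; lra.
have h4 : 0 < alpha * (1 - alpha) * sep x ^+ 2.
  by rewrite !mulr_gt0 ?subr_gt0// exprn_gt0.
by move: h2 h3 h4; lra.
Qed.

(** A distance is at most 0 only when D and T coincide, so a capture with such a payoff is also an
    interception; a finite play without capture ends by interception anyway. *)
Lemma cdg_payoff_le0 x phi chi psi z tf : play alpha x phi chi psi z tf ->
  (cdg_payoff z tf <= 0)%E <-> (forall t : R, tf = t%:E -> intercepted (z t)).
Proof.
move=> [_ _ _ _ ct]; case: tf ct => [t ct| |] /=.
- split=> [h t' [<-]|/(_ t erefl) int].
    case: ifPn h => [cap|ncap _]; last by have := ct t erefl; rewrite (negbTE ncap).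
    rewrite lee_fin => d0; rewrite intercepted_sep.
    have : dist (posD (z t)) (posT (z t)) == 0 by rewrite eq_le d0 dist_ge0.
    by rewrite dist_eq0 => /eqP DT; rewrite /sep dist_eq0 DT.
  case: ifP => // /eqP AT; move/eqP: int => AD.
  by rewrite -AD AT /dist !subrr expr0n addr0 sqrtr0.
- by split.
- by split.
Qed.

Lemma atddg_payoff_ge0 x phi chi psi z tf : play alpha x phi chi psi z tf ->
  (0 <= atddg_payoff z tf)%E <-> (forall t : R, tf = t%:E -> intercepted (z t)).
Proof.
move=> [[t0 _] _ _ _ _]; case: tf t0 => [t t0| |] //=.
- split=> [h t' [<-]|/(_ t erefl) ->]; first by case: ifP h.
  by rewrite lee_fin dist_ge0.
Qed.

Lemma cdg_payoff_ge0 x phi chi psi z tf : play alpha x phi chi psi z tf ->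
  (0 <= cdg_payoff z tf)%E <-> exists2 t : R, tf = t%:E & captured (z t).
Proof.
move=> _; case: tf => [t| |] /=; split.
- by case: ifP => // cap _; exists t.
- by move=> [t' [->] ->]; rewrite lee_fin dist_ge0.
- by [].
- by case.
- by [].
- by case.
Qed.

(** The value +oo excludes endless plays; -oo means that contact was made with T alone, and a
    distance 0 at an interception means that T is met as well. *)
Lemma atddg_payoff_le0 x phi chi psi z tf : play alpha x phi chi psi z tf ->
  (atddg_payoff z tf <= 0)%E <-> exists2 t : R, tf = t%:E & captured (z t).
Proof.
move=> [[t0 _] _ _ _ ct]; case: tf t0 ct => [t|//|] t0 ct /=; last by [].
- split.
    case: ifPn => [int|nint _]; last first.
      by exists t => //; have := ct t erefl; rewrite (negbTE nint) orbF.
    rewrite lee_fin => d0; exists t => //.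
    have : dist (posA (z t)) (posT (z t)) == 0 by rewrite eq_le d0 dist_ge0.
    by rewrite dist_eq0.
  move=> [t' [<-] /eqP AT]; case: ifP => // _.
  by rewrite AT /dist !subrr expr0n addr0 sqrtr0.
- by split => [|[]].
Qed.

Variable x : state R.
Hypothesis hx : Barrier alpha x.

Let norm_alpha : `|alpha| <= 1.
Proof. by rewrite ger0_norm ltW. Qed.

Lemma team_opt_playable : team_playable alpha x (phi_opt alpha) (psi_opt alpha).
Proof.
have phic := phi_opt_continuous alpha0 alpha1.
have psic := psi_opt_continuous alpha0 alpha1.
split; [exact: phic.1|exact: psic.1|].
by move=> chi chic; exact: play_exists.
Qed.

Lemma attacker_opt_playable : attacker_playable alpha x (chi_opt alpha).
Proof.
have chic := chi_opt_continuous alpha0 alpha1.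
by split; [exact: chic.1|move=> phi psi phic psic; exact: play_exists].
Qed.

Lemma team_opt_wins chi z tf :
  play alpha x (phi_opt alpha) chi (psi_opt alpha) z tf ->
  forall t : R, tf = t%:E -> intercepted (z t).
Proof.
move=> pl t tE; rewrite tE in pl.
by apply: (team_guarantee alpha0 alpha1 _ pl); rewrite (barrier_margin hx).1.
Qed.

Lemma attacker_opt_wins phi psi z tf :
  play alpha x phi (chi_opt alpha) psi z tf ->
  exists2 t : R, tf = t%:E & captured (z t).
Proof.
move=> pl; have [s0 l0] := barrier_margin hx.
by apply: (attacker_guarantee alpha0 alpha1 _ l0 pl); rewrite s0.
Qed.

(** The guarantees give one bound on each of the two values. For the other, playability of an
    arbitrary strategy supplies a play against the opponents' optimal one, and that play's payoff is
    bounded by the opponents' guarantee. *)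
Lemma cdg_value_barrier : cdg_value alpha x 0.
Proof.
have chic := chi_opt_continuous alpha0 alpha1.
have phic := phi_opt_continuous alpha0 alpha1.
have psic := psi_opt_continuous alpha0 alpha1.
split; apply/eqP; rewrite eq_le; apply/andP; split.
- apply: ub_ereal_sup => _ [chi [fchi pchi] ->].
  have [z [tf pl]] := pchi _ _ phic psic.
  apply: (@le_trans _ _ (cdg_payoff z tf)).
    apply: ereal_inf_lbound; exists (phi_opt alpha), (psi_opt alpha), z, tf.
    by split => //; [exact: phic.1|exact: psic.1].
  exact/(cdg_payoff_le0 pl)/(team_opt_wins pl).
- apply: (@le_trans _ _ (ereal_inf
      (attacker_outcomes alpha (@cdg_payoff R) x (chi_opt alpha)))).
    apply: le_ereal_inf_tmp => _ [phi [psi [z [tf [_ _ pl ->]]]]].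
    exact/(cdg_payoff_ge0 pl)/(attacker_opt_wins pl).
  apply: ereal_sup_ubound; exists (chi_opt alpha) => //.
  exact: attacker_opt_playable.
- apply: (@le_trans _ _ (ereal_sup
      (team_outcomes alpha (@cdg_payoff R) x (phi_opt alpha) (psi_opt alpha)))).
    apply: ereal_inf_lbound; exists (phi_opt alpha), (psi_opt alpha); split => //.
    exact: team_opt_playable.
  apply: ub_ereal_sup => _ [chi [z [tf [_ pl ->]]]].
  exact/(cdg_payoff_le0 pl)/(team_opt_wins pl).
- apply: le_ereal_inf_tmp => _ [phi [psi [[fphi fpsi pp] ->]]].
  have [z [tf pl]] := pp _ chic.
  apply: (@le_trans _ _ (cdg_payoff z tf)).
    exact/(cdg_payoff_ge0 pl)/(attacker_opt_wins pl).
  by apply: ereal_sup_ubound; exists (chi_opt alpha), z, tf; split => //; exact: chic.1.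
Qed.

Lemma atddg_value_barrier : atddg_value alpha x 0.
Proof.
have chic := chi_opt_continuous alpha0 alpha1.
have phic := phi_opt_continuous alpha0 alpha1.
have psic := psi_opt_continuous alpha0 alpha1.
split; apply/eqP; rewrite eq_le; apply/andP; split.
- apply: ub_ereal_sup => _ [phi [psi [[fphi fpsi pp] ->]]].
  have [z [tf pl]] := pp _ chic.
  apply: (@le_trans _ _ (atddg_payoff z tf)).
    by apply: ereal_inf_lbound; exists (chi_opt alpha), z, tf; split => //; exact: chic.1.
  exact/(atddg_payoff_le0 pl)/(attacker_opt_wins pl).
- apply: (@le_trans _ _ (ereal_inf
      (team_outcomes alpha (@atddg_payoff R) x (phi_opt alpha) (psi_opt alpha)))).
    apply: le_ereal_inf_tmp => _ [chi [z [tf [_ pl ->]]]].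
    exact/(atddg_payoff_ge0 pl)/(team_opt_wins pl).
  apply: ereal_sup_ubound; exists (phi_opt alpha), (psi_opt alpha); split => //.
  exact: team_opt_playable.
- apply: (@le_trans _ _ (ereal_sup
      (attacker_outcomes alpha (@atddg_payoff R) x (chi_opt alpha)))).
    apply: ereal_inf_lbound; exists (chi_opt alpha) => //.
    exact: attacker_opt_playable.
  apply: ub_ereal_sup => _ [phi [psi [z [tf [_ _ pl ->]]]]].
  exact/(atddg_payoff_le0 pl)/(attacker_opt_wins pl).
- apply: le_ereal_inf_tmp => _ [chi [fchi pchi] ->].
  have [z [tf pl]] := pchi _ _ phic psic.
  apply: (@le_trans _ _ (atddg_payoff z tf)).
    exact/(atddg_payoff_ge0 pl)/(team_opt_wins pl).
  apply: ereal_sup_ubound; exists (phi_opt alpha), (psi_opt alpha), z, tf.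
  by split => //; [exact: phic.1|exact: psic.1].
Qed.

Lemma saddle0_equiv phi chi psi :
  cdg_saddle alpha x phi chi psi 0 <-> atddg_saddle alpha x phi chi psi 0.
Proof.
split=> -[prof team att]; split => //.
- move=> _ [chi' [z [tf [fchi pl ->]]]].
  apply/(atddg_payoff_ge0 pl)/(cdg_payoff_le0 pl).
  by apply: team; exists chi', z, tf.
- move=> _ [phi' [psi' [z [tf [fphi fpsi pl ->]]]]].
  apply/(atddg_payoff_le0 pl)/(cdg_payoff_ge0 pl).
  by apply: att; exists phi', psi', z, tf.
- move=> _ [chi' [z [tf [fchi pl ->]]]].
  apply/(cdg_payoff_le0 pl)/(atddg_payoff_ge0 pl).
  by apply: team; exists chi', z, tf.
- move=> _ [phi' [psi' [z [tf [fphi fpsi pl ->]]]]].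
  apply/(cdg_payoff_ge0 pl)/(atddg_payoff_le0 pl).
  by apply: att; exists phi', psi', z, tf.
Qed.

Lemma cdg_opt_saddle :
  cdg_saddle alpha x (phi_opt alpha) (chi_opt alpha) (psi_opt alpha) 0.
Proof.
split.
- split; [exact: team_opt_playable|exact: attacker_opt_playable|].
  have [_ _] := team_opt_playable; apply; exact: chi_opt_continuous.
- move=> _ [chi [z [tf [_ pl ->]]]].
  exact/(cdg_payoff_le0 pl)/(team_opt_wins pl).
- move=> _ [phi [psi [z [tf [_ _ pl ->]]]]].
  exact/(cdg_payoff_ge0 pl)/(attacker_opt_wins pl).
Qed.

End BarrierGame.

Theorem theorem3 (R : realType) (alpha : R) (x : state R)
    (halpha0 : 0 < alpha) (halpha1 : alpha < 1)
    (hx : Barrier alpha x) :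
  (exists V : R, cdg_value alpha x V /\ atddg_value alpha x V) /\
  (exists phi chi psi : state R -> R, cdg_optimal alpha x phi chi psi) /\
  (forall phi chi psi : state R -> R,
     cdg_optimal alpha x phi chi psi <-> atddg_optimal alpha x phi chi psi).
Proof.
have vc := cdg_value_barrier halpha0 halpha1 hx.
have va := atddg_value_barrier halpha0 halpha1 hx.
split; first by exists 0.
split.
  exists (phi_opt alpha), (chi_opt alpha), (psi_opt alpha), 0 => //.
  exact: cdg_opt_saddle.
move=> phi chi psi; split=> -[V [vV _] sV].
  (* The value is unique, so every optimal profile is a saddle point at level 0. *)
  have V0 : V = 0 by move: vV; rewrite vc.1 => -[].
  by exists 0 => //; apply/saddle0_equiv; rewrite -V0.
have V0 : V = 0 by move: vV; rewrite va.1 => -[].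
by exists 0 => //; apply/saddle0_equiv; rewrite -V0.
Qed.
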